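(* Let $d\in\mathbb{N}$ and let $D$ be a digraph with $\Delta^0(D)\leq d$ and $g(D)\geq 1000d^2$ such that $V^0(D)$ is $k$-sparse in $D$ for some $k\geq 20d^2+2$. Then $D$ is consistent.
   Context: A digraph is finite, has no loops and, between two distinct vertices, at most one edge in each direction. $\Delta^0(D)=\max_{v}\max\{d^+(v),d^-(v)\}$. The girth $g(D)$ is the length of a shortest directed cycle in $D$ (infinite if none). For $v\in V(D)$, $\mathrm{ex}_D(v)=|d^+_D(v)-d^-_D(v)|$, $\mathrm{ex}(D)=\frac12\sum_v\mathrm{ex}_D(v)$, and $V^0(D)=\{v:\mathrm{ex}_D(v)=0\}$. $D$ is consistent if its edge set can be partitioned into exactly $\mathrm{ex}(D)$ directed paths. $D^\diamond$ denotes the underlying undirected graph of $D$, and $\mathrm{dist}_{D^\diamond}$ its graph distance. A set $S\subseteq V(D)$ is $k$-sparse in $D$ if for every $u\in S$ there is at most one vertex $v\in S\setminus\{u\}$ with $\mathrm{dist}_{D^\diamond}(u,v)\leq k$. *)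

(* Defs.v *)
From HB Require Import structures.
From mathcomp Require Import all_boot all_order all_algebra.

Set Implicit Arguments.
Unset Strict Implicit.
Unset Printing Implicit Defensive.

Import IntDist.

Record digraph := Digraph {
  vertex :> finType;
  arc : rel vertex;
  arc_irr : irreflexive arc
}.

(* Lengths live in N with infinity added: [None] stands for infinity. *)
Definition exnat := option nat.

Definition exnat_ge (x : exnat) (m : nat) : bool :=
  if x is Some n then m <= n else true.

Definition exnat_le (x : exnat) (m : nat) : bool :=
  if x is Some n then n <= m else false.

(* Least n <= b satisfying P, infinity if there is none. *)
Definition least_upto (b : nat) (P : pred nat) : exnat :=
  ohead [seq n <- iota 0 b.+1 | P n].

Section DigraphDefs.

Variable D : digraph.

Definition outdeg (v : D) : nat := #|[set w | arc v w]|.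
Definition indeg (v : D) : nat := #|[set w | arc w v]|.

Definition maxsemideg : nat := \max_(v : D) maxn (outdeg v) (indeg v).

Definition arcs : {set D * D} := [set a | arc a.1 a.2].

Definition dicycle (c : seq D) : bool := (c != [::]) && ucycleb (@arc D) c.

(* A directed cycle has at most #|D| vertices, so the bound on the search is
   harmless; see [girth_geP] and [girth_leP]. *)
Definition girth : exnat :=
  least_upto #|D| (fun n => [exists c : n.-tuple D, dicycle c]).

Definition excess_at (v : D) : nat := `|outdeg v - indeg v|.

(* The halved sum is always even; see [excess_sum_even]. *)
Definition excess : nat := (\sum_(v : D) excess_at v)./2.

Definition V0 : {set D} := [set v | excess_at v == 0].

Definition dipath (x : D) (p : seq D) : bool :=
  path (@arc D) x p && uniq (x :: p).

Definition path_arcs (x : D) (p : seq D) : {set D * D} :=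
  [set:: zip (x :: p) p].

(* Blocks of a [partition] are nonempty, so every path used has at least one
   edge. *)
Definition consistent : Prop :=
  exists P : {set {set D * D}},
    [/\ partition P arcs,
        forall A, A \in P -> exists x p, dipath x p /\ A = path_arcs x p
      & #|P| = excess].

Definition underlying : rel D := [rel u v | arc u v || arc v u].

Definition upath (u v : D) (p : seq D) : bool :=
  [&& path underlying u p, uniq (u :: p) & last u p == v].

Definition udist (u v : D) : exnat :=
  least_upto #|D| (fun n => [exists p : n.-tuple D, upath u v p]).

Definition sparse (k : nat) (S : {set D}) : Prop :=
  forall u, u \in S -> #|[set v in S :\ u | exnat_le (udist u v) k]| <= 1.

End DigraphDefs.

Lemma least_upto_geP (b m : nat) (P : pred nat) :
  reflect (forall n, n <= b -> P n -> m <= n) (exnat_ge (least_upto b P) m).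
Proof.
rewrite /least_upto; set s := filter _ _.
have memE n : (n \in s) = P n && (n <= b).
  by rewrite mem_filter mem_iota add0n ltnS.
have : sorted ltn s by rewrite sorted_filter ?iota_ltn_sorted //; exact: ltn_trans.
case: s memE => [|h s] memE /= srt.
  by apply: ReflectT => n nb Pn; have := memE n; rewrite Pn nb.
apply: (iffP idP) => [mh n nb Pn | H].
- have := memE n; rewrite Pn nb inE /= => /orP[/eqP -> //|ns].
  have /allP/(_ _ ns) : all (ltn h) s by exact: (order_path_min ltn_trans srt).
  by move=> /= hn; exact: leq_trans mh (ltnW hn).
- by have := memE h; rewrite mem_head => /esym/andP[Ph hb]; exact: H.
Qed.

Lemma least_upto_leP (b m : nat) (P : pred nat) :
  reflect (exists n, [/\ n <= b, P n & n <= m]) (exnat_le (least_upto b P) m).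
Proof.
have E : exnat_le (least_upto b P) m = ~~ exnat_ge (least_upto b P) m.+1.
  by case: (least_upto b P) => [n|] //=; rewrite -leqNgt.
rewrite E; apply: (iffP idP) => [H | [n [nb Pn nm]]].
- have : exists n : 'I_b.+1, P n && (n <= m).
    apply/existsP; apply: contraNT H => /existsPn H.
    apply/least_upto_geP => n nb Pn; rewrite ltnNge; apply/negP => nm.
    by have := H (Ordinal (nb : n < b.+1)); rewrite /= Pn nm.
  by case=> n /andP[Pn nm]; exists n; split=> //; rewrite -ltnS.
- by apply/negP => /least_upto_geP/(_ n nb Pn); rewrite ltnNge nm.
Qed.

Lemma girth_geP (D : digraph) (m : nat) :
  reflect (forall c : seq D, dicycle c -> m <= size c) (exnat_ge (girth D) m).
Proof.
apply: (iffP (least_upto_geP _ _ _)) => [H c dc | H n _ /existsP[c /H]].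
- apply: H; last by apply/existsP; exists (in_tuple c).
  by case/andP: dc => _ /andP[_ /card_uniqP <-]; exact: max_card.
- by rewrite size_tuple.
Qed.

Lemma girth_leP (D : digraph) (m : nat) :
  reflect (exists2 c : seq D, dicycle c & size c <= m) (exnat_le (girth D) m).
Proof.
apply: (iffP (least_upto_leP _ _ _)) => [[n [_ /existsP[c dc] nm]] | [c dc cm]].
- by exists c; rewrite ?size_tuple.
- exists (size c); split=> //; last by apply/existsP; exists (in_tuple c).
  by case/andP: dc => _ /andP[_ /card_uniqP <-]; exact: max_card.
Qed.

Lemma udist_leP (D : digraph) (u v : D) (m : nat) :
  reflect (exists2 p, upath u v p & size p <= m) (exnat_le (udist u v) m).
Proof.
apply: (iffP (least_upto_leP _ _ _)) => [[n [_ /existsP[p up] nm]] | [p up pm]].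
- by exists p; rewrite ?size_tuple.
- exists (size p); split=> //; last by apply/existsP; exists (in_tuple p).
  case/and3P: up => _ /card_uniqP pu _.
  by apply: ltnW; have := max_card [in u :: p]; rewrite pu.
Qed.

Lemma excess_sum_even (D : digraph) : ~~ odd (\sum_(v : D) excess_at v).
Proof.
have odd_sum (F : D -> nat) :
    odd (\sum_v F v) = \big[addb/false]_v odd (F v).
  exact: (big_morph odd oddD erefl).
have Eout : \sum_(v : D) outdeg v = \sum_(v : D) indeg v.
  under eq_bigr do rewrite /outdeg -sum1_card.
  under [RHS]eq_bigr do rewrite /indeg -sum1_card.
  rewrite (exchange_big_dep xpredT) //=.
  by apply: eq_bigr => w _; apply: eq_bigl => v; rewrite !inE.
have Eodd v : odd (@excess_at D v) = odd (outdeg v + indeg v).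
  rewrite /excess_at; case: (leqP (indeg v) (outdeg v)) => h.
    by rewrite distnEl // oddB // oddD.
  by rewrite distnEr ?(ltnW h) // oddB ?(ltnW h) // oddD addbC.
by rewrite odd_sum (eq_bigr _ (fun v _ => Eodd v)) -odd_sum big_split /= Eout addnn odd_double.
Qed.

(* Main.v *)
Require Import Defs.
From HB Require Import structures.
From mathcomp Require Import all_boot all_order all_algebra.
From mathcomp Require Import zify.
From Stdlib Require Import Classical.

(** Remove edge-disjoint simple cycles from [D] until the remaining arc set [A]
is acyclic; a decomposition of [A] into the fewest paths (the trails) then has
all starts at vertices of positive and all ends at vertices of negative excess,
and any decomposition of [D] with this property has exactly [excess D] paths. It
remains to absorb the removed cycles.

Two pieces (subpaths of trails running from a positive to a negative vertex) can
often be combined with a cycle [c] into two paths with the same endpoints. Every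
nonzero vertex [v] of [c] starts or ends a trail, and the run of equal signs at
that end of the trail gives candidate pieces. If some trail has an arc
[a -> b], [a] positive and [b] negative, which is a chord of [c], take one for
which the part of [c] from [b] to [a] is shortest. By the girth condition that
part is long, by sparsity most of its vertices are usable, and each of those
gives a piece matching the chord. If there is no such chord, most vertices give a
piece meeting [c] in just one of its ends, and two pieces of the same kind match.
So each cycle has [64 d^2] vertex-disjoint gadgets, each of which interferes with
at most [16 d^2] gadgets of other cycles, and a counting argument selects one
gadget per cycle without interference. The arcs of [A] not used by the selected
pieces are still acyclic and still have their excesses of the right signs. *)

Set Implicit Arguments.
Unset Strict Implicit.
Unset Printing Implicit Defensive.

(** * Walks and cycles as vertex lists, with their edge lists *)

Section Walks.

Variable T : eqType.
Implicit Types (x y z : T) (s c : seq T) (E : seq (T * T)) (t : T * seq T).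

Definition walk_edges s : seq (T * T) := zip s (behead s).

(** A one-vertex list gives the loop at that vertex, so two equal neighbours in a walk also count as
    a closed cycle. *)
Definition cycle_edges c : seq (T * T) :=
  if c is x :: s then walk_edges (x :: s ++ [:: x]) else [::].

Definition vertices t : seq T := t.1 :: t.2.

Definition target t : T := last t.1 t.2.

Lemma walk_edges_cons x y s :
  walk_edges (x :: y :: s) = (x, y) :: walk_edges (y :: s).
Proof. by []. Qed.

Lemma walk_edges_cat s1 x s2 :
  walk_edges (s1 ++ x :: s2) = walk_edges (s1 ++ [:: x]) ++ walk_edges (x :: s2).
Proof. by elim: s1 => [|y [|z s1] IH] //; rewrite !cat_cons !walk_edges_cons -cat_cons IH. Qed.

Lemma walk_edges_join x s1 s2 :
  walk_edges (x :: s1 ++ s2) = walk_edges (x :: s1) ++ walk_edges (last x s1 :: s2).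
Proof. by elim: s1 x => [|y s1 IH] x //=; rewrite walk_edges_cons IH. Qed.

(* These two rules, unlike [walk_edges_cat], terminate when iterated. *)
Lemma walk_edges_split_cons x s1 y z s2 :
  walk_edges (x :: s1 ++ y :: z :: s2) =
  walk_edges (x :: s1 ++ [:: y]) ++ (y, z) :: walk_edges (z :: s2).
Proof. by rewrite -cat_cons walk_edges_cat. Qed.

Lemma walk_edges_split_cat x s1 y s2 z s3 :
  walk_edges (x :: s1 ++ y :: s2 ++ z :: s3) =
  walk_edges (x :: s1 ++ [:: y]) ++ walk_edges (y :: s2 ++ z :: s3).
Proof. by rewrite -cat_cons walk_edges_cat. Qed.

Definition walk_edgesE :=
  (walk_edges_split_cons, walk_edges_split_cat, walk_edges_cons).

Lemma walk_edges_infix s1 s s2 : {subset walk_edges s <= walk_edges (s1 ++ s ++ s2)}.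
Proof.
case: s => [|x s] e // es; rewrite cat_cons walk_edges_cat mem_cat.
by rewrite walk_edges_join mem_cat es orbT.
Qed.

Lemma mem_walk_edges e s : e \in walk_edges s -> (e.1 \in s) && (e.2 \in s).
Proof.
elim: s => [|x [|y s] IH] //; rewrite walk_edges_cons inE => /orP[/eqP -> /=|/IH].
  by rewrite !inE !eqxx /= orbT.
by case/andP=> h1 h2; rewrite ![_ \in x :: _]in_cons h1 h2 !orbT.
Qed.

Lemma cycle_edges_rot s1 s2 :
  perm_eq (cycle_edges (s1 ++ s2)) (cycle_edges (s2 ++ s1)).
Proof.
case: s1 s2 => [|x s1] [|y s2]; rewrite ?cats0 ?cat0s //=.
by rewrite -!catA !cat_cons !walk_edges_split_cat perm_catC.
Qed.

Lemma cycle_rot_to c x : uniq c -> x \in c ->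
  exists s, [/\ uniq (x :: s), c =i x :: s, size c = (size s).+1 &
                perm_eq (cycle_edges c) (cycle_edges (x :: s))].
Proof.
move=> uc /rot_to[i s E]; exists s.
rewrite -E rot_uniq uc -(size_rot i c) E; split=> // [y|].
  by rewrite -E mem_rot.
by rewrite -E /rot -{1}(cat_take_drop i c) cycle_edges_rot.
Qed.

Lemma uniq_walk_edges s : uniq s -> uniq (walk_edges s).
Proof.
elim: s => [|x [|y s] IH] // /andP[xs us]; rewrite walk_edges_cons cons_uniq IH // andbT.
by apply/negP => /mem_walk_edges /andP[/= h _]; rewrite h in xs.
Qed.

Lemma unzip1_walk_edges s x : unzip1 (walk_edges (s ++ [:: x])) = s.
Proof. by elim: s => [|y [|z s] IH] //; rewrite cat_cons walk_edges_cons /= -[in RHS]IH. Qed.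

Lemma uniq_cycle_edges c : uniq c -> uniq (cycle_edges c).
Proof.
case: c => [|x s] // us; apply: (@map_uniq _ _ fst).
by rewrite -[map _ _]/(unzip1 _) [cycle_edges _]/= -cat_cons unzip1_walk_edges.
Qed.

(** * Degree counts along walks and cycles *)

Definition edges_from v E := count (fun e => e.1 == v) E.
Definition edges_into v E := count (fun e => e.2 == v) E.

(** Inner vertices contribute equally to both sides; only the start and the end unbalance the
    counts. The additive form avoids truncated subtraction. *)
Lemma walk_degrees v x s :
  edges_from v (walk_edges (x :: s)) + (last x s == v) =
  edges_into v (walk_edges (x :: s)) + (x == v).
Proof. by elim: s x => [|y s IH] x //; rewrite walk_edges_cons /= -addnA IH; lia. Qed.

Lemma cycle_degrees v c :
  edges_from v (cycle_edges c) = edges_into v (cycle_edges c).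
Proof.
case: c => [|x s] //=.
by have := walk_degrees v x (s ++ [:: x]); rewrite last_cat /= => /addIn.
Qed.

Lemma walks_degrees v (ps : seq (T * seq T)) :
  edges_from v (flatten [seq walk_edges (vertices t) | t <- ps]) + count (fun t => target t == v) ps =
  edges_into v (flatten [seq walk_edges (vertices t) | t <- ps]) + count (fun t => t.1 == v) ps.
Proof.
elim: ps => [|t ps IH] //=; rewrite /edges_from /edges_into !count_cat.
have := walk_degrees v t.1 t.2; rewrite -/(vertices t) -/(target t).
by move: IH; rewrite /edges_from /edges_into; lia.
Qed.

Lemma cycles_degrees v (cs : seq (seq T)) :
  edges_from v (flatten (map cycle_edges cs)) = edges_into v (flatten (map cycle_edges cs)).
Proof.
elim: cs => [|c cs IH] //=; rewrite /edges_from /edges_into !count_cat.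
by congr (_ + _) => //; exact: cycle_degrees.
Qed.

(** * Acyclic edge lists, and decompositions into paths and into cycles *)

Definition acyclic E := forall c, c != [::] -> uniq c -> ~ {subset cycle_edges c <= E}.

(** A return to the head of a walk whose tail has no repetition would close a cycle. *)
Lemma acyclic_walk_uniq E s : acyclic E -> {subset walk_edges s <= E} -> uniq s.
Proof.
move=> aE; elim: s => [|x s IH] // sE.
have us : uniq s.
  by apply: IH => e es; apply: sE; case: (s) es => // y s' es; rewrite walk_edges_cons inE es orbT.
rewrite cons_uniq us andbT; apply/negP => xs.
case/splitPr: xs us sE => s1 s2 us sE.
apply: (aE (x :: s1)) => //.
  by move: us; rewrite /= cat_uniq /= negb_or => /and3P[-> /andP[-> _] _].
move=> e es; apply: sE; rewrite /= in es.
by rewrite -cat_cons walk_edges_cat mem_cat es.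
Qed.

Lemma acyclic_sub E1 E2 : {subset E1 <= E2} -> acyclic E2 -> acyclic E1.
Proof. by move=> s12 a2 c c0 uc sc; apply: (a2 c) => // e /sc/s12. Qed.

(* A decomposition into the fewest walks: two walks that could be concatenated
   would be, and in an acyclic edge set the concatenation is again a path. *)
Lemma acyclic_paths E : acyclic E ->
  exists ps : seq (T * seq T),
    [/\ perm_eq (flatten [seq walk_edges (vertices t) | t <- ps]) E,
        forall t, t \in ps -> uniq (vertices t) /\ t.2 != [::] &
        forall t t', t \in ps -> t' \in ps -> target t != t'.1].
Proof.
move=> aE.
suff: forall n ps, size ps <= n -> perm_eq (flatten [seq walk_edges (vertices t) | t <- ps]) E ->
    all (fun t => t.2 != [::]) ps ->
  exists ps' : seq (T * seq T),
    [/\ perm_eq (flatten [seq walk_edges (vertices t) | t <- ps']) E,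
        forall t, t \in ps' -> uniq (vertices t) /\ t.2 != [::] &
        forall t t', t \in ps' -> t' \in ps' -> target t != t'.1].
  (* Begin with every edge as a walk of its own. *)
  move=> /(_ _ [seq (e.1, [:: e.2]) | e <- E] (leqnn _)); apply; last first.
    by apply/allP => t /mapP[e _ ->].
  by rewrite (_ : flatten _ = E) //; elim: (E) => [|[x y] E' /= ->].
elim=> [|n IH] ps sz pE ne.
  by exists ps; case: ps sz pE ne.
have us t : t \in ps -> uniq (vertices t).
  move=> tp; apply: (acyclic_walk_uniq aE) => e et; rewrite -(perm_mem pE).
  by apply/flatten_mapP; exists t.
case: (boolP (all (fun t => all (fun t' => target t != t'.1) ps) ps)) => [/allP h|].
  exists ps; split=> // [t tp|t t' tp t'p]; first by split; [exact: us|exact: (allP ne)].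
  exact: (allP (h t tp)).
rewrite -has_predC => /hasP[t tp /=]; rewrite -has_predC => /hasP[t' t'p /= /negPn/eqP tt'].
(* A walk is not joined to itself: a nonempty path does not end where it starts. *)
have ntt' : t' != t.
  apply/eqP => E'; rewrite E' in tt'; have := us t tp; have := allP ne t tp.
  case: t tt' {tp t'p E'} => x [|y p] //= <- _.
  by rewrite /target /= mem_last.
have p1 := perm_to_rem tp.
have t'r : t' \in rem t ps.
  by have := perm_mem p1 t'; rewrite t'p inE (negbTE ntt') /= => <-.
have p2 := perm_to_rem t'r.
have pp : perm_eq ps [:: t, t' & rem t' (rem t ps)].
  by rewrite (perm_trans p1) // perm_cons.
apply: (IH ((t.1, t.2 ++ t'.2) :: rem t' (rem t ps))).
- by have := perm_size pp; move=> /= e; move: sz; rewrite e.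
- rewrite -(permPr pE) perm_sym.
  have := perm_flatten (perm_map (fun t => walk_edges (vertices t)) pp).
  move=> /perm_trans; apply.
  by rewrite /= catA perm_cat2r {3}/vertices /= walk_edges_join -[last _ _]/(target t) tt'.
- move: ne; rewrite (perm_all _ pp) /= => /and3P[h1 h2 h3]; rewrite h3 andbT.
  by case: (t.2) h1.
Qed.

(* Vertices that are both a start and an end do not occur, so starts have
   positive and ends negative imbalance. *)
Lemma unlinked_start (ps : seq (T * seq T)) t :
  (forall t t', t \in ps -> t' \in ps -> target t != t'.1) -> t \in ps ->
  let E := flatten [seq walk_edges (vertices t) | t <- ps] in
  edges_into t.1 E < edges_from t.1 E /\ edges_from (target t) E < edges_into (target t) E.
Proof.
move=> h tp E.
have H := walks_degrees t.1 ps; have H' := walks_degrees (target t) ps.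
have s1 : 0 < count (fun t' => t'.1 == t.1) ps by rewrite -has_count; apply/hasP; exists t.
have s2 : 0 < count (fun t' => target t' == target t) ps by rewrite -has_count; apply/hasP; exists t.
have z1 : count (fun t' => target t' == t.1) ps = 0.
  apply/eqP; rewrite -leqn0 leqNgt -has_count; apply/hasPn => t' t'p; exact: h.
have z2 : count (fun t' => t'.1 == target t) ps = 0.
  apply/eqP; rewrite -leqn0 leqNgt -has_count; apply/hasPn => t' t'p; rewrite eq_sym; exact: h.
by split; move: H H'; rewrite -/E; lia.
Qed.

(** As long as a cycle is left, take out its edges; there is at least one, so the list shrinks. *)
Lemma cycle_decomposition E : uniq E ->
  exists (cs : seq (seq T)) A,
    [/\ perm_eq E (flatten (map cycle_edges cs) ++ A), acyclic A &
        forall c, c \in cs -> (c != [::]) && uniq c].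
Proof.
have [n] := ubnP (size E); elim: n E => [|n IH] E //= szE uE.
case: (classic (acyclic E)) => [aE|].
  by exists [::], E; split.
move=> naE; have [c Hc] := not_all_ex_not _ _ naE.
have [c0 {}Hc] := imply_to_and _ _ Hc.
have [uc {Hc}/NNPP sc] := imply_to_and _ _ Hc.
have ucE := uniq_cycle_edges uc.
have pE : perm_eq E (cycle_edges c ++ [seq e <- E | e \notin cycle_edges c]).
  apply: uniq_perm => //.
    rewrite cat_uniq ucE filter_uniq //= andbT.
    by apply/hasPn => e; rewrite mem_filter => /andP[].
  by move=> e; rewrite mem_cat mem_filter; case: (boolP (e \in cycle_edges c)) => [/sc|].
have [||cs [A [p1 aA hcs]]] := IH [seq e <- E | e \notin cycle_edges c].
- have := perm_size pE; rewrite size_cat.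
  have : 0 < size (cycle_edges c) by case: c c0 {uc sc ucE pE} => [|x [|y s]].
  by move=> h0 Es; rewrite -ltnS (leq_ltn_trans _ szE) // Es -[X in X < _]add0n ltn_add2r.
- by rewrite filter_uniq.
exists (c :: cs), A; split=> //.
  by rewrite (perm_trans pE) //= -catA perm_cat2l.
by move=> c'; rewrite inE => /orP[/eqP ->|/hcs //]; rewrite c0.
Qed.

End Walks.

Arguments walk_edges : simpl never.

Lemma card_bigcup_leq (I T : finType) (P : pred I) (F : I -> {set T}) :
  #|\bigcup_(i | P i) F i| <= \sum_(i | P i) #|F i|.
Proof.
elim/big_ind2: _ => [|A m B n hA hB|//]; first by rewrite cards0.
by apply: leq_trans (leq_add hA hB); rewrite cardsU leq_subr.
Qed.

(** * Independent transversals by counting *)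

Section Transversal.

Variables (I : finType) (g K : nat) (conflict : rel (I * 'I_g)).
Hypothesis conflict_sym : symmetric conflict.
Hypothesis conflict_deg : forall p,
  #|[set p' : I * 'I_g | (p'.1 != p.1) && conflict p p']| <= K.

Notation choice_fun := {ffun I -> 'I_g}.

(** Choices outside [X] stay free, so that all counts range over the same total functions. *)
Definition conflict_free (X : {set I}) (f : choice_fun) :=
  [forall i in X, forall j in X, (i != j) ==> ~~ conflict (i, f i) (j, f j)].

Definition update (f : choice_fun) i a : choice_fun := [ffun j => if j == i then a else f j].

(** Since [P] does not look at coordinate [i], overwriting that coordinate maps the functions with
    value [b] there injectively to those with value [c]; so all [g] values occur equally often. *)
Lemma card_update_invariant (P : pred choice_fun) i a :
  (forall f b, P (update f i b) = P f) ->
  g * #|[set f | P f & f i == a]| = #|[set f | P f]|.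
Proof.
move=> inv.
have le_ab b c : #|[set f | P f & f i == b]| <= #|[set f | P f & f i == c]|.
  have inj : {in [set f | P f & f i == b] &, injective (fun f => update f i c)}.
    move=> f1 f2; rewrite !inE => /andP[_ /eqP e1] /andP[_ /eqP e2] e; apply/ffunP => j.
    have := congr1 (fun h : choice_fun => h j) e; rewrite !ffunE.
    by case: (j =P i) => [->|]; rewrite ?e1 ?e2.
  rewrite -(card_in_imset inj); apply: subset_leq_card; apply/subsetP => h.
  by case/imsetP=> f; rewrite !inE => /andP[Pf _] ->; rewrite inv Pf ffunE !eqxx.
rewrite -[RHS]sum1dep_card (partition_big (fun f : choice_fun => f i) xpredT) //=.
rewrite (eq_bigr (fun _ => #|[set f | P f & f i == a]|)) => [|b _].
  by rewrite sum_nat_const card_ord.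
by rewrite sum1dep_card; apply/eqP; rewrite eqn_leq !le_ab.
Qed.

Lemma conflict_free_update (X : {set I}) f i a :
  i \notin X -> conflict_free X (update f i a) = conflict_free X f.
Proof.
move=> iX; apply: eq_forallb_in => j jX; apply: eq_forallb_in => l lX.
have ji : j != i by apply: contraNneq iX => <-.
have li : l != i by apply: contraNneq iX => <-.
by rewrite !ffunE (negbTE ji) (negbTE li).
Qed.

Lemma conflict_freeS (X Y : {set I}) f : X \subset Y -> conflict_free Y f -> conflict_free X f.
Proof.
move=> XY /forall_inP h; apply/forall_inP => i iX; apply/forall_inP => j jX.
exact: (forall_inP (h _ (subsetP XY _ iX))) _ (subsetP XY _ jX).
Qed.

(* Rosenfeld's counting argument: adding one more index at most halves the
   number of conflict-free choices. *)
Lemma conflict_free_half (X : {set I}) i : 4 * K <= g -> 0 < g -> i \notin X ->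
  #|[set f | conflict_free X f]| <= 2 * #|[set f | conflict_free (i |: X) f]|.
Proof.
move=> gK g0; have [n] := ubnP #|X|; elim: n X i => // n IH X i szX iX.
set M := #|_|.
(* Fixing the choices at [i] and at [p.1] gains a factor [g] each; what remains is conflict-free on
   [X] without [p.1], and induction bounds the number of such functions by [2 * M]. *)
have bad_le a (p : I * 'I_g) : p.1 \in X ->
    g * (g * #|[set f | (conflict_free X f && (f p.1 == p.2)) && (f i == a)]|) <= 2 * M.
  move=> pX; have ip : p.1 != i by apply: contraNneq iX => <-.
  pose P := fun f : choice_fun => conflict_free (X :\ p.1) f && (f p.1 == p.2).
  have sub : #|[set f | (conflict_free X f && (f p.1 == p.2)) && (f i == a)]| <=
             #|[set f | P f & f i == a]|.
    apply: subset_leq_card; apply/subsetP => f; rewrite !inE /P => /andP[/andP[h1 ->] ->].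
    by rewrite (conflict_freeS _ h1) // subsetDl.
  apply: (@leq_trans (g * (g * #|[set f | P f & f i == a]|))); first by rewrite !leq_mul2l sub !orbT.
  rewrite card_update_invariant; last first.
    move=> f b; rewrite /P conflict_free_update; last by rewrite !inE (negbTE iX) andbF.
    by rewrite ffunE (negbTE ip).
  rewrite (card_update_invariant (P := conflict_free (X :\ p.1))); last first.
    by move=> f b; rewrite conflict_free_update // !inE eqxx.
  rewrite /M -[in leqRHS](setD1K pX); apply: IH; last by rewrite !inE eqxx.
  by move: szX; rewrite (cardsD1 p.1 X) pX; lia.
pose S a := [set p : I * 'I_g | (p.1 \in X) && conflict (i, a) p].
have S_le a : #|S a| <= K.
  apply: leq_trans (conflict_deg (i, a)); apply: subset_leq_card; apply/subsetP => p.
  by rewrite !inE /= => /andP[pX ->]; rewrite andbT; apply: contraNneq iX => <-.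
pose Bad := \bigcup_(a : 'I_g) \bigcup_(p in S a)
   [set f : choice_fun | (conflict_free X f && (f p.1 == p.2)) && (f i == a)].
have cover : [set f | conflict_free X f] \subset [set f | conflict_free (i |: X) f] :|: Bad.
  apply/subsetP => f; rewrite !inE => hf.
  case: (boolP (f \in Bad)) => [_|nB]; first by rewrite orbT.
  rewrite orbF.
  have ok j : j \in X -> ~~ conflict (i, f i) (j, f j).
    move=> jX; apply: contra nB => cf; apply/bigcupP; exists (f i) => //.
    by apply/bigcupP; exists (j, f j); rewrite !inE /= ?jX // hf !eqxx.
  apply/forall_inP => j; rewrite !inE => jX; apply/forall_inP => l; rewrite !inE => lX.
  case/orP: jX => [/eqP ->|jX]; case/orP: lX => [/eqP ->|lX].
  - by rewrite eqxx.
  - by rewrite ok // implybT.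
  - by rewrite conflict_sym ok // implybT.
  - exact: (forall_inP ((forall_inP hf) _ jX)).
have leMB : M <= #|[set f | conflict_free (i |: X) f]| + #|Bad|.
  by apply: leq_trans (subset_leq_card cover) _; rewrite cardsU leq_subr.
(* Sum [bad_le] over the [g] values of [a] and the at most [K] pairs [p] for each, then cancel one
   [g]. *)
have leB : g * #|Bad| <= 2 * K * M.
  rewrite -(leq_pmul2l g0).
  have cup_le : #|Bad| <= \sum_(a : 'I_g) \sum_(p in S a)
      #|[set f : choice_fun | (conflict_free X f && (f p.1 == p.2)) && (f i == a)]|.
    apply: leq_trans (card_bigcup_leq _ _) _.
    by apply: leq_sum => a _; exact: card_bigcup_leq.
  apply: (@leq_trans (\sum_(a : 'I_g) \sum_(p in S a) 2 * M)).
    apply: leq_trans (_ : g * (g * (\sum_(a : 'I_g) \sum_(p in S a)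
      #|[set f : choice_fun | (conflict_free X f && (f p.1 == p.2)) && (f i == a)]|)) <= _).
      by rewrite !leq_mul2l cup_le !orbT.
    rewrite !big_distrr /=; apply: leq_sum => a _; rewrite !big_distrr /=.
    by apply: leq_sum => p; rewrite inE => /andP[pX _]; exact: bad_le.
  apply: (@leq_trans (\sum_(a : 'I_g) K * (2 * M))).
    by apply: leq_sum => a _; rewrite sum_nat_const leq_mul2r S_le orbT.
  by rewrite sum_nat_const card_ord; lia.
have : 2 * #|Bad| <= M by rewrite -(leq_pmul2l g0); nia.
by lia.
Qed.

(** Adding the indices one by one at most halves a positive count each time, so a choice without
    conflicts survives. *)
Lemma independent_transversal : 4 * K <= g -> 0 < g ->
  exists f : I -> 'I_g, forall i j, i != j -> ~~ conflict (i, f i) (j, f j).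
Proof.
move=> gK g0.
suff: 0 < #|[set f | conflict_free setT f]|.
  case/card_gt0P=> f; rewrite inE => /forall_inP h; exists f => i j ij.
  by have /forall_inP/(_ j (in_setT j))/implyP := h i (in_setT i); apply.
move: [set: I] => X; have [n] := ubnP #|X|; elim: n X => // n IH X szX.
have [->|[i iX]] := set_0Vmem X.
  apply/card_gt0P; exists [ffun=> Ordinal g0]; rewrite inE.
  by apply/forall_inP => i; rewrite inE.
have iD : i \notin X :\ i by rewrite !inE eqxx.
have := conflict_free_half gK g0 iD; rewrite setD1K //.
have : 0 < #|[set f | conflict_free (X :\ i) f]|.
  by apply: IH; move: szX; rewrite (cardsD1 i X) iX; lia.
by lia.
Qed.

End Transversal.

(** * Signs of vertices, and path decompositions of the right size *)

Section Excess.

Variable D : digraph.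
Implicit Types (v : D) (t : D * seq D).

Definition pos v := indeg v < outdeg v.
Definition neg v := outdeg v < indeg v.

Lemma pos_neg v : pos v -> neg v -> False.
Proof. by rewrite /pos /neg; lia. Qed.

Lemma V0E v : (v \in V0 D) = ~~ pos v && ~~ neg v.
Proof. by rewrite inE /excess_at /pos /neg; lia. Qed.

Lemma outdegE v : outdeg v = edges_from v (enum (arcs D)).
Proof.
rewrite /outdeg /edges_from -size_filter -(@card_imset _ _ (pair v)) => [|x y []//].
rewrite cardE; apply: perm_size.
apply: uniq_perm => [||[x y]]; [exact: enum_uniq|by apply: filter_uniq; exact: enum_uniq|].
rewrite mem_enum mem_filter mem_enum inE /=; apply/imsetP/andP => [[w]|[/eqP -> h]].
  by rewrite inE => h [-> ->].
by exists y; rewrite ?inE.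
Qed.

Lemma indegE v : indeg v = edges_into v (enum (arcs D)).
Proof.
rewrite /indeg /edges_into -size_filter -(@card_imset _ _ (pair^~ v)) => [|x y []//].
rewrite cardE; apply: perm_size.
apply: uniq_perm => [||[x y]]; [exact: enum_uniq|by apply: filter_uniq; exact: enum_uniq|].
rewrite mem_enum mem_filter mem_enum inE /=; apply/imsetP/andP => [[w]|[/eqP -> h]].
  by rewrite inE => h [-> ->].
by exists x; rewrite ?inE.
Qed.

Definition good_path t := [&& uniq (vertices t), t.2 != [::], pos t.1 & neg (target t)].

(** At a positive vertex paths only start, at a negative one they only end, and at the others they
    do neither. So [excess_at v] counts the path ends at [v], and every path is counted twice in the
    sum. *)
Lemma excess_sizeE (ps : seq (D * seq D)) :
  perm_eq (flatten [seq walk_edges (vertices t) | t <- ps]) (enum (arcs D)) ->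
  all good_path ps -> size ps = excess D.
Proof.
move=> pE /allP good.
have sumcount (f : D * seq D -> D) : \sum_v count (fun t => f t == v) ps = size ps.
  elim: ps {pE good} => [|t ps IH] /=; first by rewrite big1.
  rewrite big_split /= IH (bigD1 (f t)) //= eqxx big1 ?addn0 // => v.
  by rewrite eq_sym => /negbTE ->.
suff ex v : excess_at v = count (fun t => t.1 == v) ps + count (fun t => target t == v) ps.
  by rewrite /excess (eq_bigr _ (fun v _ => ex v)) big_split /= !sumcount addnn doubleK.
have := walks_degrees v ps.
rewrite /edges_from /edges_into !(permP pE) -[X in X + _ = _]/(edges_from v _) -[X in _ = X + _]/(edges_into v _).
rewrite -outdegE -indegE.
have h1 : 0 < count (fun t => t.1 == v) ps -> pos v.
  by rewrite -has_count => /hasP[t /good /and4P[_ _ h _] /eqP <-].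
have h2 : 0 < count (fun t => target t == v) ps -> neg v.
  by rewrite -has_count => /hasP[t /good /and4P[_ _ _ h] /eqP <-].
move: h1 h2; set a := count (fun t : D * seq D => t.1 == v) ps; set b := count (fun t : D * seq D => target t == v) ps.
by move: a b => a b; rewrite /pos /neg /excess_at; lia.
Qed.

Lemma walk_path x s : all (fun e : D * D => Defs.arc e.1 e.2) (walk_edges (x :: s)) = path (@Defs.arc D) x s.
Proof. by elim: s x => [|y s IH] x //; rewrite walk_edges_cons /= IH. Qed.

(** The edge lists enumerate every arc once, so distinct positions in [ps] give disjoint nonempty
    blocks, as many as there are walks. *)
Lemma consistent_of_paths (ps : seq (D * seq D)) :
  perm_eq (flatten [seq walk_edges (vertices t) | t <- ps]) (enum (arcs D)) ->
  all good_path ps -> consistent D.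
Proof.
move=> pE good.
pose F t := [set:: walk_edges (vertices t)].
have uF : uniq (flatten [seq walk_edges (vertices t) | t <- ps]) by rewrite (perm_uniq pE) enum_uniq.
have ne t : t \in ps -> exists e, e \in walk_edges (vertices t).
  move=> /(allP good) /and4P[_ h _ _]; case: t h => x [|y p] // _.
  by exists (x, y); rewrite walk_edges_cons mem_head.
have same e : forall t t', t \in ps -> t' \in ps ->
    e \in walk_edges (vertices t) -> e \in walk_edges (vertices t') -> t = t'.
  elim: ps {pE good ne} uF => [|t0 ps IH] //=.
  rewrite cat_uniq => /and3P[_ /hasPn dis /IH{}IH] t t'.
  rewrite !inE => /orP[/eqP ->|tp] /orP[/eqP ->|t'p] //; last exact: IH.
    move=> h1 h2; have /dis : e \in flatten [seq walk_edges (vertices t) | t <- ps].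
      by apply/flatten_mapP; exists t'.
    by rewrite /= h1.
  move=> h1 h2; have /dis : e \in flatten [seq walk_edges (vertices t) | t <- ps].
    by apply/flatten_mapP; exists t.
  by rewrite /= h2.
have ups : uniq ps.
  elim: ps {pE good same} uF ne => [|t0 ps IH] //=.
  rewrite cat_uniq => /and3P[_ /hasPn dis /IH{}IH] ne.
  rewrite IH => [|t tp]; last by apply: ne; rewrite inE tp orbT.
  rewrite andbT; apply/negP => tp; have [e he] := ne t0 (mem_head _ _).
  have /dis : e \in flatten [seq walk_edges (vertices t) | t <- ps].
    by apply/flatten_mapP; exists t0.
  by rewrite /= he.
have injF : {in ps &, injective F}.
  move=> t t' tp t'p E; have [e he] := ne t tp; apply: (same e) => //.
  by have := congr1 (fun A : {set D * D} => e \in A) E; rewrite !inE he.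
exists [set:: map F ps]; split.
- apply/and3P; split.
  + apply/eqP/setP => e; rewrite -[RHS]mem_enum -(perm_mem pE).
    apply/bigcupP/flatten_mapP => [[A]|[t tp et]].
      by rewrite inE => /mapP[t tp ->]; rewrite inE => et; exists t.
    by exists (F t); rewrite ?inE // map_f.
  + apply/trivIsetP => A B; rewrite !inE => /mapP[t tp ->] /mapP[t' t'p ->] nFF.
    apply/pred0P => e /=; apply/negbTE/negP; rewrite !inE => /andP[h1 h2].
    by move: nFF; rewrite (same e t t') // eqxx.
  + rewrite inE; apply/mapP => -[t tp E]; have [e he] := ne t tp.
    by have := congr1 (fun A : {set D * D} => e \in A) E; rewrite !inE he.
- move=> A; rewrite inE => /mapP[t tp ->]; exists t.1, t.2; split=> //.
  have /and4P[ut _ _ _] := allP good t tp; rewrite /dipath -walk_path; apply/andP; split=> //.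
  apply/allP => e et; have : e \in enum (arcs D).
    by rewrite -(perm_mem pE); apply/flatten_mapP; exists t.
  by rewrite mem_enum inE.
- rewrite -(excess_sizeE pE good) -(size_map F) cardsE; apply/card_uniqP.
  by rewrite map_inj_in_uniq.
Qed.

End Excess.

(** Reduces distinctness of rearranged concatenations to linear arithmetic on multiplicities. *)
Lemma uniq_count_le1 (T : eqType) (s : seq T) :
  reflect (forall x, count_mem x s <= 1) (uniq s).
Proof.
apply: (iffP idP) => [us x|h]; first by rewrite count_uniq_mem // leq_b1.
apply: count_mem_uniq => x; have := h x; rewrite -has_pred1 has_count.
by case: (count_mem x s) => [|[]].
Qed.

(** * Vertices of zero excess near a directed path *)

Section Underlying.

Variable D : digraph.

Lemma walk_prefix (e : rel D) x p y : path e x p -> y \in x :: p ->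
  exists r, [/\ path e x r, last x r = y & size r <= size p].
Proof.
move=> ep yp; case/splitPl: yp ep => p1 p2 <-; rewrite cat_path => /andP[e1 _].
by exists p1; rewrite size_cat leq_addr.
Qed.

(** By symmetry a walk can be reversed, so the order in which it meets [y] and [z] does not
    matter. *)
Lemma walk_between (e : rel D) x p y z : symmetric e -> path e x p ->
  y \in x :: p -> z \in x :: p ->
  exists r, [/\ path e y r, last y r = z & size r <= size p].
Proof.
move=> se; elim: p x => [|w p IH] x ep yp zp.
  by move: yp zp; rewrite !inE => /eqP -> /eqP ->; exists [::].
case: (y =P x) => [->|/eqP yx]; first exact: walk_prefix.
case: (z =P x) => [->|/eqP zx].
  have [r [er lr sr]] := walk_prefix ep yp.
  exists (rev (belast x r)); rewrite size_rev size_belast; split=> //.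
    by rewrite -lr rev_path (eq_path (e' := e)) // => a b; rewrite se.
  case: r er lr sr => [|a r] //= _ lr _.
  by rewrite rev_cons last_rcons.
case/andP: ep => _ ep; move: yp zp; rewrite !inE (negbTE yx) (negbTE zx) /= -!in_cons => yp zp.
by have [r [h1 h2 h3]] := IH w ep yp zp; exists r; split=> //; rewrite ltnW.
Qed.

Lemma walk_udist x y p k : path (@underlying D) x p -> last x p = y -> size p <= k ->
  exnat_le (udist x y) k.
Proof.
move=> ep lp sp; apply/udist_leP; move: lp; case/shortenP: ep => p' ep' up' sub lp.
exists p'; first by apply/and3P; split=> //; apply/eqP.
apply: leq_trans sp; apply: uniq_leq_size => //.
by case/andP: up'.
Qed.

(** Neighbours are included so that a trail avoiding this set has a sign one arc away from [s] as
    well. *)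
Definition zeros_near (s : seq D) : {set D} :=
  [set z in V0 D | has (fun y => (z == y) || underlying y z) s].

Lemma underlying_sym : symmetric (@underlying D).
Proof. by move=> x y; rewrite /underlying /= orbC. Qed.

Lemma walk_underlying x p : path (@Defs.arc D) x p -> path (@underlying D) x p.
Proof. by apply: sub_path => a b ab; rewrite /underlying /= ab. Qed.

(** Two such zeros are joined by a walk of length at most [1 + m + 1], and sparsity allows each only
    one partner within distance [k]. *)
Lemma zeros_near_short k m x p : sparse k (V0 D) -> m + 2 <= k ->
  path (@Defs.arc D) x p -> size (x :: p) <= m.+1 -> #|zeros_near (x :: p)| <= 2.
Proof.
move=> sp mk /walk_underlying ep sz.
have [->|[z0 z0Q]] := set_0Vmem (zeros_near (x :: p)); first by rewrite cards0.
rewrite (cardsD1 z0) z0Q add1n ltnS.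
have z0V : z0 \in V0 D by move: z0Q; rewrite inE => /andP[].
apply: leq_trans (sp z0 z0V); apply: subset_leq_card; apply/subsetP => z.
rewrite in_setD1 => /andP[nz zQ]; rewrite inE in_setD1 nz.
move: z0Q zQ; rewrite !inE => /andP[_ /hasP[y0 y0s h0]] /andP[-> /hasP[y ys h]] /=.
have [r [er lr sr]] := walk_between underlying_sym ep y0s ys.
have [a [ea la sa]] : exists a, [/\ path (@underlying D) z0 a, last z0 a = y0 & size a <= 1].
  case/orP: h0 => [/eqP ->|h0]; first by exists [::].
  by exists [:: y0]; rewrite /= [underlying _ _]underlying_sym h0.
have [b [eb lb sb]] : exists b, [/\ path (@underlying D) y b, last y b = z & size b <= 1].
  case/orP: h => [/eqP ->|h]; first by exists [::].
  by exists [:: z]; rewrite /= h.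
apply: (@walk_udist _ _ (a ++ r ++ b)).
- by rewrite !cat_path ea la er lr.
- by rewrite !last_cat la lr.
- by rewrite !size_cat; move: sz => /=; lia.
Qed.

Lemma zeros_near_cat s1 s2 : zeros_near (s1 ++ s2) = zeros_near s1 :|: zeros_near s2.
Proof. by apply/setP => z; rewrite !inE has_cat -andb_orr. Qed.

(** Cut [s] into blocks of [m.+1] vertices, with at most two zeros near each. *)
Lemma zeros_near_card k m (s : seq D) : sparse k (V0 D) -> m + 2 <= k ->
  sorted (@Defs.arc D) s -> #|zeros_near s| <= 2 * (size s %/ m.+1).+1.
Proof.
move=> sp mk; have [n] := ubnP (size s); elim: n s => // n IH s sz ss.
have [le|gt] := leqP (size s) m.+1.
  case: s ss le {sz} => [|x p] ss le.
    by rewrite (_ : zeros_near _ = set0) ?cards0 //; apply/setP => z; rewrite !inE andbF.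
  by apply: leq_trans (zeros_near_short sp mk ss le) _; rewrite mulnS leq_addr.
have Es := cat_take_drop m.+1 s; rewrite -[in zeros_near s]Es zeros_near_cat.
have st : size (take m.+1 s) = m.+1 by rewrite size_take gt.
have h1 : #|zeros_near (take m.+1 s)| <= 2.
  have : sorted (@Defs.arc D) (take m.+1 s) by apply: take_sorted.
  by case: (take m.+1 s) st => [|x p] // st h; apply: (zeros_near_short sp mk h); rewrite st.
have h2 : #|zeros_near (drop m.+1 s)| <= 2 * (size (drop m.+1 s) %/ m.+1).+1.
  by apply: IH; [rewrite size_drop; lia|apply: drop_sorted].
have e : size s = m.+1 + size (drop m.+1 s) by rewrite size_drop; lia.
apply: leq_trans (leq_trans _ (leq_add h1 h2)) _; first by rewrite cardsU leq_subr.
by rewrite [in leqRHS]e divnDl ?dvdnn // divnn /= add1n [leqRHS]mulnS.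
Qed.

End Underlying.

(** * Merging a cycle with two pieces *)

Section Absorption.

Variable D : digraph.
Implicit Types (c s : seq D) (R P : D * seq D).

Definition absorbs c R1 R2 := exists P1 P2,
  [/\ good_path P1, good_path P2 &
      perm_eq (walk_edges (vertices P1) ++ walk_edges (vertices P2))
        (cycle_edges c ++ walk_edges (vertices R1) ++ walk_edges (vertices R2))].

Lemma absorbsC c R1 R2 : absorbs c R1 R2 -> absorbs c R2 R1.
Proof.
case=> P1 [P2 [g1 g2 pE]]; exists P1, P2; split=> //.
by rewrite (permPl pE) perm_cat2l perm_catC.
Qed.

Lemma absorbs_perm c c' R1 R2 :
  perm_eq (cycle_edges c) (cycle_edges c') -> absorbs c' R1 R2 -> absorbs c R1 R2.
Proof.
move=> pc [P1 [P2 [g1 g2 pE]]]; exists P1, P2; split=> //.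
by rewrite (permPl pE) perm_cat2r perm_sym.
Qed.

Lemma target_cat (q x : D) r s : target (q, r ++ x :: s) = last x s.
Proof. by rewrite /target /= last_cat. Qed.

(** One path follows the first piece to [x], the cycle to [z] and then the second piece; the other
    is the rest of the cycle, from [z] to [x]. *)
Lemma absorbs_head_tail c q r1 x c1 z c2 r2 :
  perm_eq (cycle_edges c) (cycle_edges (x :: c1 ++ z :: c2)) ->
  uniq (x :: c1 ++ z :: c2) -> uniq (q :: r1 ++ x :: c1 ++ z :: r2) -> r2 != [::] ->
  pos q -> neg x -> pos z -> neg (target (z, r2)) ->
  absorbs c (q, r1 ++ [:: x]) (z, r2).
Proof.
move=> pc uc u1 r20 pq nx pz nr2; apply: absorbs_perm pc _.
have u2 : uniq (z :: c2 ++ [:: x]).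
  apply/uniq_count_le1 => y; move/uniq_count_le1/(_ y): uc.
  by rewrite /= !count_cat /=; lia.
exists (q, r1 ++ x :: c1 ++ z :: r2), (z, c2 ++ [:: x]); split.
- by rewrite /good_path u1 /= pq target_cat last_cat /= nr2 andbT /=; case: (r1).
- by rewrite /good_path u2 /= pz target_cat nx andbT /=; case: (c2).
apply/permP => a; rewrite /vertices [(_, _).1]/= [(_, _).2]/=.
rewrite (_ : cycle_edges (x :: c1 ++ z :: c2) = walk_edges (x :: c1 ++ z :: c2 ++ [:: x])); last first.
  by rewrite /= -catA.
case: r2 r20 nr2 u1 => // y r2 _ _ _.
by rewrite !walk_edgesE !count_cat /= ?count_cat; lia.
Qed.

(** Each piece continues along the cycle to the end of the other, so the two ends are exchanged. *)
Lemma absorbs_heads c q1 r1 x1 c1 q2 r2 x2 c2 :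
  perm_eq (cycle_edges c) (cycle_edges (x1 :: c1 ++ x2 :: c2)) ->
  uniq (q1 :: r1 ++ x1 :: c1 ++ [:: x2]) -> uniq (q2 :: r2 ++ x2 :: c2 ++ [:: x1]) ->
  pos q1 -> neg x1 -> pos q2 -> neg x2 ->
  absorbs c (q1, r1 ++ [:: x1]) (q2, r2 ++ [:: x2]).
Proof.
move=> pc u1 u2 pq1 nx1 pq2 nx2; apply: absorbs_perm pc _.
exists (q1, r1 ++ x1 :: c1 ++ [:: x2]), (q2, r2 ++ x2 :: c2 ++ [:: x1]); split.
- by rewrite /good_path u1 /= pq1 target_cat last_cat /= nx2 andbT /=; case: (r1).
- by rewrite /good_path u2 /= pq2 target_cat last_cat /= nx1 andbT /=; case: (r2).
apply/permP => a; rewrite /vertices [(_, _).1]/= [(_, _).2]/=.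
rewrite (_ : cycle_edges (x1 :: c1 ++ x2 :: c2) = walk_edges (x1 :: c1 ++ x2 :: c2 ++ [:: x1])); last first.
  by rewrite /= -catA.
by rewrite !walk_edgesE !count_cat /= ?count_cat; lia.
Qed.

(** From each start the cycle is followed to the start of the other piece, which is then taken to
    its end. *)
Lemma absorbs_tails c z1 r1 c1 z2 r2 c2 :
  perm_eq (cycle_edges c) (cycle_edges (z1 :: c1 ++ z2 :: c2)) ->
  uniq (z1 :: c1 ++ z2 :: r2) -> uniq (z2 :: c2 ++ z1 :: r1) -> r1 != [::] -> r2 != [::] ->
  pos z1 -> neg (target (z1, r1)) -> pos z2 -> neg (target (z2, r2)) ->
  absorbs c (z1, r1) (z2, r2).
Proof.
move=> pc u1 u2 r10 r20 pz1 n1 pz2 n2; apply: absorbs_perm pc _.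
exists (z1, c1 ++ z2 :: r2), (z2, c2 ++ z1 :: r1); split.
- by rewrite /good_path u1 /= pz1 target_cat n2 andbT /=; case: (c1).
- by rewrite /good_path u2 /= pz2 target_cat n1 andbT /=; case: (c2).
apply/permP => a; rewrite /vertices [(_, _).1]/= [(_, _).2]/=.
rewrite (_ : cycle_edges (z1 :: c1 ++ z2 :: c2) = walk_edges (z1 :: c1 ++ z2 :: c2 ++ [:: z1])); last first.
  by rewrite /= -catA.
case: r1 r10 n1 u2 => // y1 r1 _ _ _; case: r2 r20 n2 u1 => // y2 r2 _ _ _.
by rewrite !walk_edgesE !count_cat /= ?count_cat; lia.
Qed.

End Absorption.

(** * Splitting and flattening lists *)

Lemma first_split (T : Type) (p : pred T) s : has p s ->
  exists s1 x s2, [/\ s = s1 ++ x :: s2, p x & ~~ has p s1].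
Proof.
elim: s => [|y s IH] //=; case: (boolP (p y)) => [py _|npy /= /IH[s1 [x [s2 [-> px ns1]]]]].
  by exists [::], y, s.
by exists (y :: s1), x, s2; rewrite /= negb_or npy.
Qed.

Lemma last_split (T : Type) (p : pred T) s : has p s ->
  exists s1 x s2, [/\ s = s1 ++ x :: s2, p x & ~~ has p s2].
Proof.
elim: s => [|y s IH] //=; case: (boolP (has p s)) => [/IH[s1 [x [s2 [-> px ns2]]]] _|ns].
  by exists (y :: s1), x, s2.
by rewrite orbF => py; exists [::], y, s.
Qed.

Lemma mem_split (T : eqType) (x : T) s : x \in s -> exists s1 s2, s = s1 ++ x :: s2.
Proof. by case/splitPr=> s1 s2; exists s1, s2. Qed.

Lemma cycle_edges_rotE (T : eqType) (s1 s2 c c' : seq T) :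
  perm_eq (cycle_edges c) (cycle_edges (s1 ++ s2)) -> c' = s2 ++ s1 ->
  perm_eq (cycle_edges c) (cycle_edges c').
Proof. by move=> h ->; apply: (perm_trans h); exact: cycle_edges_rot. Qed.

Lemma uniq_cat_disjoint (T : eqType) (s t : seq T) :
  uniq s -> uniq t -> ~~ has [in t] s -> uniq (s ++ t).
Proof. by move=> us ut st; rewrite cat_uniq us ut has_sym st. Qed.

Lemma uniq_flatten_map (I T : eqType) (F : I -> seq T) s : uniq s ->
  (forall i, i \in s -> uniq (F i)) ->
  (forall i j x, i \in s -> j \in s -> x \in F i -> x \in F j -> i = j) ->
  uniq (flatten [seq F i | i <- s]).
Proof.
elim: s => [|i s IH] //= /andP[is_ us] uF dF; apply: uniq_cat_disjoint.
- by apply: uF; rewrite mem_head.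
- apply: IH => // [j js|j l x js ls]; first by apply: uF; rewrite inE js orbT.
  by apply: dF; rewrite inE ?js ?ls orbT.
apply/hasPn => x xi; apply/negP => /flatten_mapP[j js xj].
by move: is_; rewrite (dF i j x) ?js // inE ?eqxx ?js ?orbT.
Qed.

Lemma flatten_map_inj (I T : eqType) (F : I -> seq T) s i0 j l x :
  uniq (flatten [seq F i | i <- s]) -> j < size s -> l < size s ->
  x \in F (nth i0 s j) -> x \in F (nth i0 s l) -> j = l.
Proof.
elim: s j l => [|i s IH] // j l /=; rewrite cat_uniq => /and3P[_ /hasPn dis us].
have dis' n : n < size s -> x \in F i -> x \in F (nth i0 s n) -> False.
  move=> ns xi xn; suff /dis : x \in flatten [seq F i | i <- s] by rewrite /= xi.
  by apply/flatten_mapP; exists (nth i0 s n); rewrite ?mem_nth.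
case: j l => [|j] [|l] //= js ls xj xl; first by case: (dis' l).
  by case: (dis' j).
by congr _.+1; exact: IH.
Qed.

(** * Trails, and how many of them meet a vertex *)

Section Trails.

Variables (D : digraph) (d k : nat) (cs : seq (seq D)) (A : seq (D * D)) (ts : seq (D * seq D)).
Hypothesis outdeg_le : forall v : D, outdeg v <= d.
Hypothesis indeg_le : forall v : D, indeg v <= d.
Hypothesis girth_le : forall c : seq D, dicycle c -> 1000 * d ^ 2 <= size c.
Hypothesis k_ge : 20 * d ^ 2 + 2 <= k.
Hypothesis V0_sparse : sparse k (V0 D).
Hypothesis arcs_perm : perm_eq (enum (arcs D)) (flatten (map (@cycle_edges D) cs) ++ A).
Hypothesis A_acyclic : acyclic A.
Hypothesis cs_cycles : forall c, c \in cs -> (c != [::]) && uniq c.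
Hypothesis ts_perm : perm_eq (flatten [seq walk_edges (vertices t) | t <- ts]) A.
Hypothesis ts_good : all (@good_path D) ts.

(** Cycles enter and leave [v] equally often, so the sign of its excess can be read off in [A]. *)
Lemma arcs_degrees (v : D) :
  outdeg v = edges_from v (flatten (map (@cycle_edges D) cs)) + edges_from v A /\
  indeg v = edges_from v (flatten (map (@cycle_edges D) cs)) + edges_into v A.
Proof.
rewrite outdegE indegE {2}cycles_degrees /edges_from /edges_into.
by rewrite !(permP arcs_perm) !count_cat.
Qed.

Lemma A_arc e : e \in A -> Defs.arc e.1 e.2.
Proof.
move=> eA; have : e \in enum (arcs D) by rewrite (perm_mem arcs_perm) mem_cat eA orbT.
by rewrite mem_enum inE.
Qed.

Lemma trail_edges t e : t \in ts -> e \in walk_edges (vertices t) -> e \in A.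
Proof. by move=> tts et; rewrite -(perm_mem ts_perm); apply/flatten_mapP; exists t. Qed.

Lemma cycle_arc c e : c \in cs -> e \in cycle_edges c -> Defs.arc e.1 e.2.
Proof.
move=> ccs ec; have : e \in enum (arcs D).
  by rewrite (perm_mem arcs_perm) mem_cat; apply/orP; left; apply/flatten_mapP; exists c.
by rewrite mem_enum inE.
Qed.

Lemma dicycle_edges (c : seq D) : c != [::] -> uniq c ->
  (forall e, e \in cycle_edges c -> Defs.arc e.1 e.2) -> dicycle c.
Proof.
move=> c0 uc hc; rewrite /dicycle c0 /ucycleb uc andbT /=.
case: c c0 uc hc => [|x s] // _ _ hc; rewrite /= -cats1 -walk_path.
exact/allP.
Qed.

(** The default [(v, [::])] is never returned at a vertex of nonzero excess, by [pos_trail] and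
    [neg_trail]. *)
Definition trail (v : D) : D * seq D :=
  if pos v then head (v, [::]) [seq t <- ts | t.1 == v]
  else head (v, [::]) [seq t <- ts | target t == v].

Lemma pos_trail v : pos v -> trail v \in ts /\ (trail v).1 = v.
Proof.
move=> pv; rewrite /trail pv.
have : has (fun t : D * seq D => t.1 == v) ts.
  rewrite has_count; have := walks_degrees v ts.
  rewrite /edges_from /edges_into !(permP ts_perm) -/(edges_from v A) -/(edges_into v A).
  have [] := arcs_degrees v; move: pv; rewrite /pos.
  by set a := count _ ts; set b := count _ ts; move: a b; lia.
rewrite has_filter; case E: (filter _ _) => [|t l] // _.
have : t \in [seq t <- ts | t.1 == v] by rewrite E mem_head.
by rewrite mem_filter => /andP[/eqP ? ?].
Qed.

Lemma neg_trail v : neg v -> trail v \in ts /\ target (trail v) = v.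
Proof.
move=> nv; rewrite /trail; case: ifP => [/pos_neg/(_ nv)//|_].
have : has (fun t : D * seq D => target t == v) ts.
  rewrite has_count; have := walks_degrees v ts.
  rewrite /edges_from /edges_into !(permP ts_perm) -/(edges_from v A) -/(edges_into v A).
  have [] := arcs_degrees v; move: nv; rewrite /neg.
  by set a := count _ ts; set b := count _ ts; move: a b; lia.
rewrite has_filter; case E: (filter _ _) => [|t l] // _.
have : t \in [seq t <- ts | target t == v] by rewrite E mem_head.
by rewrite mem_filter => /andP[/eqP ? ?].
Qed.

Lemma nonzero_trail v : v \notin V0 D -> trail v \in ts.
Proof.
by rewrite V0E negb_and !negbK => /orP[/pos_trail[]|/neg_trail[]].
Qed.

(** Every trail through [y] uses an edge of [A] at [y], and trails share no edges. *)
Lemma trails_through (y : D) : count (fun t => y \in vertices t) ts <= 2 * d.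
Proof.
have : edges_from y A + edges_into y A <= 2 * d.
  have [e1 e2] := arcs_degrees y; have := outdeg_le y; have := indeg_le y; lia.
apply: leq_trans; rewrite /edges_from /edges_into -!(permP ts_perm).
elim: (ts) ts_good => [|t l IH] //= /andP[gt /IH{}IH]; rewrite !count_cat.
have : (y \in vertices t) <= count (fun e => e.1 == y) (walk_edges (vertices t)) +
                            count (fun e => e.2 == y) (walk_edges (vertices t)).
  case: (boolP (y \in vertices t)) => // yt.
  case: t gt yt => x [|z p] /and4P[_ // _ _ _] yt; rewrite addn_gt0 -!has_count; apply/orP.
  case/predU1P: yt => [->|yt]; [left|right]; first by rewrite walk_edges_cons /= eqxx.
  have : y \in unzip2 (walk_edges (x :: z :: p)) by rewrite unzip2_zip.
  by case/mapP=> e he ->; apply/hasP; exists e => /=.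
by move=> h; rewrite addnACA leq_add.
Qed.

Definition hits (y : D) : {set D} := [set w | (w \notin V0 D) && (y \in vertices (trail w))].

(** A trail can be [trail w] only for its own start and end, hence twice the bound of
    [trails_through]. *)
Lemma hits_card y : #|hits y| <= 4 * d.
Proof.
pose L := [seq t <- ts | y \in vertices t].
apply: (@leq_trans #|[set:: map fst L ++ map (@target D) L]|).
  apply: subset_leq_card; apply/subsetP => w; rewrite [w \in hits y]in_set => /andP[w0 yw].
  rewrite in_set mem_cat.
  have wL : trail w \in L by rewrite mem_filter yw nonzero_trail.
  move: w0; rewrite V0E negb_and !negbK => /orP[/pos_trail[_ <-]|/neg_trail[_ <-]].
    by rewrite map_f.
  by rewrite [X in _ || X]map_f ?orbT.
rewrite cardsE; apply: leq_trans (card_size _) _.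
rewrite size_cat !size_map size_filter; have := trails_through y.
by rewrite -/(count _ ts); lia.
Qed.

(** Each cycle through [w] uses an arc leaving [w]. *)
Lemma cycles_through (w : D) : count (fun c => w \in c) cs <= d.
Proof.
have : edges_from w (flatten (map (@cycle_edges D) cs)) <= d.
  by have [e1 _] := arcs_degrees w; have := outdeg_le w; lia.
apply: leq_trans.
have : {subset cs <= cs} by [].
rewrite /edges_from; elim: {1 3 4}cs => [|c l IH] //= sub; rewrite count_cat leq_add ?IH //.
  have /andP[_ uc] := cs_cycles (sub c (mem_head _ _)).
  case: (boolP (w \in c)) => // wc; rewrite -has_count.
  have [s [_ _ _ pc]] := cycle_rot_to uc wc; rewrite (perm_has _ pc); apply/hasP.
  by case: s {pc} => [|y s]; [exists (w, w)|exists (w, y)]; rewrite /= ?walk_edges_cons ?mem_head.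
by move=> c' c'l; apply: sub; rewrite inE c'l orbT.
Qed.

(** [X] holds vertices already used and [Y] the ends of pieces already chosen. Each zero near [s]
    and each member of [Y] spoils at most [4 * d] vertices, too few in total to exhaust [s]. *)
Lemma pick_vertex (s : seq D) (X Y : {set D}) :
  uniq s -> sorted (@Defs.arc D) s -> 1000 * d ^ 2 <= size s -> 0 < d ->
  #|X| <= 128 * d ^ 2 -> #|Y| <= 4 ->
  exists v, [/\ v \in s, v \notin X, v \notin V0 D &
    forall y, y \in vertices (trail v) -> (y \notin zeros_near s) && (y \notin Y)].
Proof.
move=> us ss szs d0 cX cY.
pose bad := X :|: zeros_near s :|: \bigcup_(y in zeros_near s :|: Y) hits y.
have Q_le : #|zeros_near s| <= 2 * (size s %/ (20 * d ^ 2)).+1.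
  have h20 : 0 < 20 * d ^ 2 by rewrite muln_gt0 expn_gt0 d0.
  have := @zeros_near_card D k (20 * d ^ 2).-1 s V0_sparse; rewrite prednK //; apply=> //.
  by apply: leq_trans k_ge; rewrite leq_add2r leq_pred.
have bad_le : #|bad| < size s.
  have h1 : #|bad| <= #|X| + #|zeros_near s| + \sum_(y in zeros_near s :|: Y) #|hits y|.
    apply: leq_trans (leq_card_setU _ _) _; apply: leq_add; first exact: leq_card_setU.
    exact: card_bigcup_leq.
  have h2 : \sum_(y in zeros_near s :|: Y) #|hits y| <= (#|zeros_near s| + 4) * (4 * d).
    apply: (@leq_trans (\sum_(y in zeros_near s :|: Y) 4 * d)).
      by apply: leq_sum => y _; exact: hits_card.
    rewrite sum_nat_const leq_mul2r; apply/orP; right.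
    by apply: leq_trans (leq_card_setU _ _) _; rewrite leq_add2l.
  have h3 := leq_trunc_div (size s) (20 * d ^ 2).
  move: Q_le h3; set q := size s %/ _; move: (#|zeros_near s|) h1 h2 => z h1 h2 h4 h5.
  (* With n the size of [s], z is at most n/(10d^2) + 2, so [bad] has at most 128d^2 + 5dz + 16d <=
     n/2 + 154d^2 < n elements. *)
  rewrite -mulnn in szs cX h5; nia.
have [v vs nb] : exists2 v, v \in s & v \notin bad.
  apply/hasP; rewrite -[has _ _]negbK -all_predC; apply/negP => /allP h.
  have : #|[set:: s]| <= #|bad|.
    by apply: subset_leq_card; apply/subsetP => v; rewrite inE => /h /=; rewrite negbK.
  by rewrite cardsE (card_uniqP us) leqNgt bad_le.
move: nb; rewrite !in_setU !negb_or => /andP[/andP[vX vQ] vH].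
have v0 : v \notin V0 D.
  apply: contra vQ => v0; rewrite inE v0; apply/hasP; exists v => //; by rewrite eqxx.
exists v; split=> // y yv; rewrite -negb_or -in_setU; apply: contra vH => yQ.
by apply/bigcupP; exists y => //; rewrite inE v0.
Qed.

(** * Pieces of trails near a cycle, and gadgets made of two pieces *)

Lemma uniq_trail v : v \notin V0 D -> uniq (vertices (trail v)).
Proof. by move/nonzero_trail/(allP ts_good)/and4P=> []. Qed.

Definition piece w (R : D * seq D) :=
  [/\ exists s1 s2, vertices (trail w) = s1 ++ vertices R ++ s2,
      R.2 != [::], pos R.1 & neg (target R)].

Lemma piece_mem w R y : piece w R -> y \in vertices R -> y \in vertices (trail w).
Proof. by case=> [[s1 [s2 ->]] _ _ _] yR; rewrite !mem_cat yR orbT. Qed.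

Lemma piece_uniq w R : w \notin V0 D -> piece w R -> uniq (vertices R).
Proof.
move=> /uniq_trail ut [[s1 [s2 E]] _ _ _]; move: ut.
by rewrite E !cat_uniq => /and3P[_ _ /and3P[]].
Qed.

Lemma piece_edges w R e : w \notin V0 D -> piece w R -> e \in walk_edges (vertices R) -> e \in A.
Proof.
move=> /nonzero_trail tw [[s1 [s2 E]] _ _ _] eR; apply: (trail_edges tw).
by rewrite E; exact: walk_edges_infix.
Qed.

Lemma not_near_nonzero (B : seq D) y :
  y \notin zeros_near B -> has (fun b => (y == b) || underlying b y) B -> y \notin V0 D.
Proof. by move=> h hB; apply: contra h => y0; rewrite inE y0. Qed.

Lemma not_near_mem (B : seq D) y : y \notin zeros_near B -> y \in B -> y \notin V0 D.
Proof. by move=> h yB; apply: (not_near_nonzero h); apply/hasP; exists y; rewrite ?eqxx. Qed.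

(** Let [q] be the last positive vertex of the trail. Behind it, every vertex on or next to [B] is
    nonzero, hence negative. If [q] is off [B], stop at the first vertex on [B]; otherwise the arc
    leaving [q] is already a piece. *)
Lemma neg_pieces (B : seq D) v : v \in B -> neg v ->
  (forall y, y \in vertices (trail v) -> y \notin zeros_near B) ->
  (exists q r x, [/\ q \notin B, x \in B, ~~ has [in B] r & piece v (q, r ++ [:: x])]) \/
  (exists q s, q \in B /\ piece v (q, [:: s])).
Proof.
move=> vB nv far.
have v0 : v \notin V0 D by rewrite V0E nv andbF.
have [tts vE] := neg_trail nv; have /and4P[ut _ pt _] := allP ts_good _ tts.
have /last_split[t1 [q [t2 [Et pq nt2]]]] : has (@pos D) (vertices (trail v)).
  by apply/hasP; exists (trail v).1; rewrite ?mem_head.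
have lastE : last q t2 = v.
  by move: vE; rewrite /target (_ : last _ _ = last v (vertices (trail v))) // Et last_cat.
have {lastE} vt2 : v \in t2.
  case: t2 lastE {nt2 Et} => [|y t2] /= E; last by rewrite -E mem_last.
  by case: (@pos_neg D v) => //; rewrite -E.
have not_pos y : y \in t2 -> ~~ pos y by move/(hasPn nt2).
have far2 y : y \in q :: t2 -> y \notin zeros_near B.
  by move=> yt; apply: far; rewrite Et mem_cat yt orbT.
have negE y : y \in t2 -> y \notin V0 D -> neg y.
  by move=> yt; rewrite V0E negb_and !negbK (negbTE (not_pos y yt)).
case: (boolP (q \in B)) => qB; [right|left].
  case: t2 vt2 Et {nt2 not_pos} far2 negE => [|s t2] // _ Et far2 negE.
  exists q, s; split=> //; split=> //.
    by exists t1, t2; rewrite Et.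
  rewrite /target /=; apply: negE; first exact: mem_head.
  apply: (not_near_nonzero (B := B)); first by apply: far2; rewrite !inE eqxx orbT.
  apply/hasP; exists q => //; apply/orP; right; rewrite /underlying /=; apply/orP; left.
  apply: (A_arc (e := (q, s))); apply: (trail_edges tts).
  by rewrite Et walk_edges_cat mem_cat walk_edges_cons mem_head orbT.
have /first_split[r [x [r2 [E2 xB nr]]]] : has [in B] t2 by apply/hasP; exists v.
have xt2 : x \in t2 by rewrite E2 mem_cat mem_head orbT.
exists q, r, x; split=> //; split=> //.
- by exists t1, r2; rewrite Et E2 /vertices /= -catA.
- by case: (r).
- rewrite target_cat /=; apply: negE => //; apply: (not_near_mem _ xB).
  by apply: far2; rewrite inE xt2 orbT.
Qed.

(** The mirror image: [q] is the first negative vertex, and the piece starts at the last vertex on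
    [B] before it or, if [q] is on [B], at the predecessor of [q]. *)
Lemma pos_pieces (B : seq D) v : v \in B -> pos v ->
  (forall y, y \in vertices (trail v) -> y \notin zeros_near B) ->
  (exists x r q, [/\ q \notin B, x \in B, ~~ has [in B] r & piece v (x, r ++ [:: q])]) \/
  (exists s q, q \in B /\ piece v (s, [:: q])).
Proof.
move=> vB pv far.
have v0 : v \notin V0 D by rewrite V0E pv.
have [tts vE] := pos_trail pv; have /and4P[ut _ _ nt] := allP ts_good _ tts.
have /first_split[t1 [q [t2 [Et nq nt1]]]] : has (@neg D) (vertices (trail v)).
  by apply/hasP; exists (target (trail v)); rewrite ?mem_last.
have vt1 : v \in t1.
  case: t1 Et {nt1} => [|y t1] [Ey _]; last by rewrite inE -vE Ey eqxx.
  by case: (@pos_neg D v) => //; rewrite -vE Ey.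
have not_neg y : y \in t1 -> ~~ neg y by move/(hasPn nt1).
have far2 y : y \in t1 -> y \notin zeros_near B.
  by move=> yt; apply: far; rewrite Et mem_cat yt.
have posE y : y \in t1 -> y \notin V0 D -> pos y.
  by move=> yt; rewrite V0E negb_and !negbK (negbTE (not_neg y yt)) orbF.
case: (boolP (q \in B)) => qB; [right|left].
  case: (lastP t1) vt1 Et {nt1 not_neg} far2 posE => [|t1' s] // _.
  rewrite -cats1 -catA => Et far2 posE; exists s, q; split=> //; split=> //.
    by exists t1', t2; rewrite Et.
  rewrite /=; apply: posE; first by rewrite mem_cat mem_head orbT.
  apply: (not_near_nonzero (B := B)); first by apply: far2; rewrite mem_cat mem_head orbT.
  apply/hasP; exists q => //; apply/orP; right; rewrite /underlying /=; apply/orP; right.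
  apply: (A_arc (e := (s, q))); apply: (trail_edges tts).
  by rewrite Et walk_edges_cat mem_cat walk_edges_cons mem_head orbT.
have /last_split[r2 [x [r [E2 xB nr]]]] : has [in B] t1 by apply/hasP; exists v.
have xt1 : x \in t1 by rewrite E2 mem_cat mem_head orbT.
exists x, r, q; split=> //; split=> //.
- by exists r2, t2; rewrite Et E2 /vertices /= -!catA.
- by case: (r).
- by apply: posE => //; apply: (not_near_mem _ xB); exact: far2.
- by rewrite target_cat.
Qed.

(** The ends of [R1] are kept off the trail of [v] so that the two pieces have different starts,
    different ends and no common edge. *)
Definition gadget c u v R1 R2 :=
  [/\ piece u R1, piece v R2, R1.1 \notin vertices (trail v),
      target R1 \notin vertices (trail v) & absorbs c R1 R2].

Definition has_gadget (c : seq D) (X : {set D}) := exists u v R1 R2,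
  [/\ (u \in c) && (v \in c), (u \notin X) && (v \notin X),
      (u \notin V0 D) && (v \notin V0 D) & gadget c u v R1 R2].

(* [a -> b] is an arc of a trail and a chord of the cycle [c]; the part
   [b :: c1 ++ [:: a]] of [c] from [b] to [a] closes it to a directed cycle, so
   it is long. A suitable vertex [v] on this part yields a second piece, or a
   chord whose corresponding part is shorter. *)
Lemma chord_gadget n (c : seq D) u a b c1 c2 (X : {set D}) : size c1 < n -> c \in cs ->
  perm_eq (cycle_edges c) (cycle_edges (b :: c1 ++ a :: c2)) ->
  uniq (b :: c1 ++ a :: c2) -> c =i b :: c1 ++ a :: c2 ->
  u \in c -> u \notin X -> u \notin V0 D -> piece u (a, [:: b]) -> #|X| <= 128 * d ^ 2 ->
  has_gadget c X.
Proof.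
elim: n u a b c1 c2 => // n IH u a b c1 c2 szc ccs pc uc' mc uc uX u0 pu cX.
have [_ _ pa nb] := pu; rewrite /target /= in pa nb.
have d0 : 0 < d by move: pa (outdeg_le a); rewrite /pos; clear; lia.
have arcab : Defs.arc a b.
  by apply: (A_arc (e := (a, b))); apply: (piece_edges u0 pu); rewrite mem_head.
pose B := b :: c1 ++ [:: a].
have uB : uniq B.
  apply/uniq_count_le1 => y; move/uniq_count_le1/(_ y): uc'.
  by rewrite /= ?count_cat /=; clear; lia.
have B_arc e : e \in walk_edges B -> Defs.arc e.1 e.2.
  move=> eB; apply: (cycle_arc ccs); rewrite (perm_mem pc) /= -catA -cat_cons.
  by rewrite walk_edges_cat mem_cat eB.
have sB : sorted (@Defs.arc D) B by rewrite /B /sorted -walk_path; apply/allP.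
have szB : 1000 * d ^ 2 <= size B.
  apply: girth_le; apply: dicycle_edges => // e.
  rewrite /B /= -catA walk_edges_split_cons mem_cat inE => /orP[/B_arc //|/eqP ->].
  exact: arcab.
(* With [a] and [b] off the trail of [v], wherever that trail meets [B] it does so in [c1]. *)
have [|v [vB vX v0 far]] := @pick_vertex B X [set a; b] uB sB szB d0 cX.
  by rewrite cards2; case: (a != b).
have farB y : y \in vertices (trail v) -> y \notin zeros_near B by case/far/andP.
have av : a \notin vertices (trail v).
  by apply/negP => /far/andP[_]; rewrite !inE eqxx.
have bv : b \notin vertices (trail v).
  by apply/negP => /far/andP[_]; rewrite !inE eqxx orbT.
have vc : v \in c.
  by move: vB; rewrite mc !inE !mem_cat !inE => /or3P[->|->|->]; rewrite ?orbT.
have inB y : y \in vertices (trail v) -> y \in B -> y \in c1.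
  move=> yv; rewrite !inE mem_cat inE => /or3P[/eqP Ey|//|/eqP Ey].
    by rewrite -Ey yv in bv.
  by rewrite -Ey yv in av.
have done R2 : piece v R2 -> absorbs c (a, [:: b]) R2 -> has_gadget c X.
  move=> pR2 ab; exists u, v, (a, [:: b]), R2.
  by rewrite uc vc uX vX u0 v0; split.
case: (boolP (neg v)) => nv.
- case: (neg_pieces vB nv farB) => [[q [r [x [qB xB nr pR]]]]|[q [s [qB pR]]]].
  (* Along the piece to [x], along [B] to [a], over the chord to [b]; the rest of [c] leads from [a]
     to [x]. The first path stays on [B] from [x] on, so the piece may meet [c2]. *)
  + apply: (done _ pR); apply: absorbsC.
    have [_ _ pq nx] := pR; rewrite /= target_cat /= in pq nx.
    have xv : x \in vertices (trail v) by apply: (piece_mem pR); rewrite /vertices /= !(inE, mem_cat) eqxx !orbT.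
    have [d1 [d2 Ec1]] := mem_split (inB x xv xB).
    apply: (@absorbs_head_tail _ _ _ _ _ d2 _ (c2 ++ b :: d1)) => //.
    * apply: (cycle_edges_rotE (s1 := b :: d1) (s2 := x :: d2 ++ a :: c2)).
        by move: pc; rewrite Ec1 -catA.
      by rewrite /= -catA.
    * apply/uniq_count_le1 => y; move/uniq_count_le1/(_ y): uc'.
      by rewrite Ec1 /= ?count_cat /= ?count_cat /=; clear; lia.
    * have h1 : uniq (q :: r).
        by have := piece_uniq v0 pR; rewrite -[vertices _]/((q :: r) ++ [:: x]) cat_uniq => /andP[].
      have h2 : uniq ((q :: r) ++ B) by apply: uniq_cat_disjoint; rewrite //= negb_or qB nr.
      apply/uniq_count_le1 => y; move/uniq_count_le1/(_ y): h2.
      by rewrite /B Ec1 /= ?count_cat /= ?count_cat /=; clear; lia.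
  + have [_ _ pq ns] := pR; rewrite /target /= in pq ns.
    have qv : q \in vertices (trail v) by apply: (piece_mem pR); rewrite mem_head.
    have sv : s \in vertices (trail v) by apply: (piece_mem pR); rewrite !inE eqxx orbT.
    have sq : s != q by have := piece_uniq v0 pR; rewrite /= inE eq_sym => /andP[].
    have [d1 [d2 Ec1]] := mem_split (inB q qv qB).
    case: (boolP (s \in B)) => sB'; last first.
      (* Over the chord to [b], along [B] to [q], then out to [s]. *)
      apply: (done _ pR).
      apply: (@absorbs_head_tail _ _ _ [::] _ d1 _ (d2 ++ a :: c2)) => //.
      - by move: pc; rewrite Ec1 -catA.
      - by move: uc'; rewrite Ec1 -catA.
      - have h2 : uniq (s :: B) by rewrite /= sB'.
        apply/uniq_count_le1 => y; move/uniq_count_le1/(_ y): h2.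
        by rewrite /B Ec1 /= ?count_cat /= ?count_cat /=; clear; lia.
    (* If [s] comes before [q] on [B], the chord from [q] to [s] has a shorter part of [c], and
       induction applies. If it comes after, the two chords exchange their ends. *)
    have := inB s sv sB'; rewrite Ec1 mem_cat inE (negbTE sq) /= => /orP[/mem_split[f1 [f2 Ed]]|/mem_split[f1 [f2 Ed]]].
      apply: (IH v q s f2 (d2 ++ a :: c2 ++ b :: f1)) => //.
      - by move: szc; rewrite Ec1 Ed !size_cat /= ; clear; lia.
      - apply: (cycle_edges_rotE (s1 := b :: f1) (s2 := s :: f2 ++ q :: d2 ++ a :: c2)).
          by move: pc; rewrite Ec1 Ed -!catA /= -catA.
        by rewrite /= -!catA /= -!catA.
      - apply/uniq_count_le1 => y; move/uniq_count_le1/(_ y): uc'.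
        by rewrite Ec1 Ed /= ?count_cat /= ?count_cat /= ?count_cat /=; clear; lia.
      - move=> y; rewrite mc; apply: perm_mem; apply/permP => h.
      by rewrite Ec1 Ed /= ?count_cat /= ?count_cat /= ?count_cat /=; clear; lia.
    apply: (done _ pR).
    apply: (@absorbs_heads _ _ _ [::] _ (d1 ++ q :: f1) _ [::] _ (f2 ++ a :: c2)) => //.
    - by apply: (perm_trans pc); rewrite Ec1 Ed -!catA /= -!catA.
    - apply/uniq_count_le1 => y; move/uniq_count_le1/(_ y): uc'.
      by rewrite Ec1 Ed /= ?count_cat /= ?count_cat /=; clear; lia.
    - apply/uniq_count_le1 => y; move/uniq_count_le1/(_ y): uc'.
      by rewrite Ec1 Ed /= ?count_cat /= ?count_cat /=; clear; lia.
- have pv : pos v by move: v0; rewrite V0E negb_and !negbK (negbTE nv) orbF.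
  case: (pos_pieces vB pv farB) => [[x [r [q [qB xB nr pR]]]]|[s [q [qB pR]]]].
  + apply: (done _ pR).
    have [_ _ px nq] := pR; rewrite /= target_cat /= in px nq.
    have xv : x \in vertices (trail v) by apply: (piece_mem pR); rewrite mem_head.
    have [d1 [d2 Ec1]] := mem_split (inB x xv xB).
    apply: (@absorbs_head_tail _ _ _ [::] _ d1 _ (d2 ++ a :: c2)) => //.
    * by move: pc; rewrite Ec1 -catA.
    * by move: uc'; rewrite Ec1 -catA.
    * have h1 : uniq (r ++ [:: q]) by have := piece_uniq v0 pR => /andP[].
      have h2 : uniq ((r ++ [:: q]) ++ B).
        by apply: uniq_cat_disjoint; rewrite // has_cat /= orbF negb_or nr qB.
      apply/uniq_count_le1 => y; move/uniq_count_le1/(_ y): h2.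
      by rewrite /B Ec1 /= ?count_cat /= ?count_cat /=; clear; lia.
    * by case: (r).
    * by rewrite target_cat.
  + have [_ _ ps nq] := pR; rewrite /target /= in ps nq.
    have sv : s \in vertices (trail v) by apply: (piece_mem pR); rewrite mem_head.
    have qv : q \in vertices (trail v) by apply: (piece_mem pR); rewrite !inE eqxx orbT.
    have sq : s != q by have := piece_uniq v0 pR; rewrite /= inE => /andP[].
    have [d1 [d2 Ec1]] := mem_split (inB q qv qB).
    case: (boolP (s \in B)) => sB'; last first.
      apply: (done _ pR); apply: absorbsC.
      apply: (@absorbs_head_tail _ _ _ [::] _ d2 _ (c2 ++ b :: d1)) => //.
      - apply: (cycle_edges_rotE (s1 := b :: d1) (s2 := q :: d2 ++ a :: c2)).
          by move: pc; rewrite Ec1 -catA.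
        by rewrite /= -catA.
      - apply/uniq_count_le1 => y; move/uniq_count_le1/(_ y): uc'.
        by rewrite Ec1 /= ?count_cat /= ?count_cat /=; clear; lia.
      - have h2 : uniq (s :: B) by rewrite /= sB'.
        apply/uniq_count_le1 => y; move/uniq_count_le1/(_ y): h2.
        by rewrite /B Ec1 /= ?count_cat /= ?count_cat /=; clear; lia.
    (* The same alternative for the chord from [s] to [q]: here it is [s] after [q] that gives the
       shorter part. *)
    have := inB s sv sB'; rewrite Ec1 mem_cat inE (negbTE sq) /= => /orP[/mem_split[f1 [f2 Ed]]|/mem_split[f1 [f2 Ed]]].
      apply: (done _ pR).
      apply: (@absorbs_heads _ _ _ [::] _ (f1 ++ s :: f2) _ [::] _ (d2 ++ a :: c2)) => //.
      - by apply: (perm_trans pc); rewrite Ec1 Ed -!catA /= -!catA.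
      - apply/uniq_count_le1 => y; move/uniq_count_le1/(_ y): uc'.
        by rewrite Ec1 Ed /= ?count_cat /= ?count_cat /=; clear; lia.
      - apply/uniq_count_le1 => y; move/uniq_count_le1/(_ y): uc'.
        by rewrite Ec1 Ed /= ?count_cat /= ?count_cat /=; clear; lia.
    apply: (IH v s q f1 (f2 ++ a :: c2 ++ b :: d1)) => //.
    - by move: szc; rewrite Ec1 Ed !size_cat /= !size_cat /=; clear; lia.
    - apply: (cycle_edges_rotE (s1 := b :: d1) (s2 := q :: f1 ++ s :: f2 ++ a :: c2)).
        by move: pc; rewrite Ec1 Ed -catA cat_cons -catA.
      by rewrite /= -!catA /= -!catA.
    - apply/uniq_count_le1 => y; move/uniq_count_le1/(_ y): uc'.
      by rewrite Ec1 Ed /= ?count_cat /= ?count_cat /= ?count_cat /=; clear; lia.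
    - move=> y; rewrite mc; apply: perm_mem; apply/permP => h.
      by rewrite Ec1 Ed /= ?count_cat /= ?count_cat /= ?count_cat /=; clear; lia.
Qed.

Definition head_piece (c : seq D) v R := exists q r x,
  [/\ R = (q, r ++ [:: x]), x \in c, ~~ has [in c] (q :: r) & piece v R].

Definition tail_piece (c : seq D) v R := exists z r,
  [/\ R = (z, r), z \in c, ~~ has [in c] r & piece v R].

(** Both pieces meet [c] in their ends only, so continuing along [c] keeps the paths simple; the
    ends differ because [target R1] is off the trail of [v]. *)
Lemma heads_gadget (c : seq D) u v R1 R2 : c \in cs -> u \notin V0 D -> v \notin V0 D ->
  head_piece c u R1 -> head_piece c v R2 ->
  R1.1 \notin vertices (trail v) -> target R1 \notin vertices (trail v) -> gadget c u v R1 R2.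
Proof.
move=> ccs u0 v0 [q1 [r1 [x1 [E1 x1c n1 p1]]]] [q2 [r2 [x2 [E2 x2c n2 p2]]]] h1 h2; split=> //.
rewrite {}E1 {}E2 in p1 p2 h1 h2 *; rewrite target_cat /= in h1 h2.
have [_ _ pq1 nx1] := p1; have [_ _ pq2 nx2] := p2; rewrite /= !target_cat /= in pq1 nx1 pq2 nx2.
have /andP[_ uc] := cs_cycles ccs; have [s [us mc _ pc]] := cycle_rot_to uc x1c.
have x21 : x2 != x1.
  apply: contraNneq h2 => <-; apply: (piece_mem p2).
  by rewrite /vertices inE mem_cat mem_head !orbT.
have /mem_split[c1 [c2 Es]] : x2 \in s by move: x2c; rewrite mc inE (negbTE x21).
have uqr q r x w : w \notin V0 D -> piece w (q, r ++ [:: x]) -> uniq (q :: r).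
  move=> w0 /(piece_uniq w0); rewrite -[vertices _]/((q :: r) ++ [:: x]) cat_uniq.
  by case/and3P.
have dis q r : ~~ has [in c] (q :: r) -> uniq (q :: r) -> uniq ((q :: r) ++ x1 :: s).
  by move=> nh uh; apply: uniq_cat_disjoint => //; rewrite -(eq_has mc).
apply: (@absorbs_heads _ _ _ _ _ c1 _ _ _ c2) => //; first by rewrite -Es.
- apply/uniq_count_le1 => y; move/uniq_count_le1/(_ y): (dis _ _ n1 (uqr _ _ _ _ u0 p1)).
  by rewrite Es /= ?count_cat /= ?count_cat /= ?count_cat /=; clear; lia.
- apply/uniq_count_le1 => y; move/uniq_count_le1/(_ y): (dis _ _ n2 (uqr _ _ _ _ v0 p2)).
  by rewrite Es /= ?count_cat /= ?count_cat /= ?count_cat /=; clear; lia.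
Qed.

Lemma tails_gadget (c : seq D) u v R1 R2 : c \in cs -> u \notin V0 D -> v \notin V0 D ->
  tail_piece c u R1 -> tail_piece c v R2 ->
  R1.1 \notin vertices (trail v) -> target R1 \notin vertices (trail v) -> gadget c u v R1 R2.
Proof.
move=> ccs u0 v0 [z1 [r1 [E1 z1c n1 p1]]] [z2 [r2 [E2 z2c n2 p2]]] h1 h2; split=> //.
rewrite {}E1 {}E2 in p1 p2 h1 h2 *; rewrite /= in h1.
have [_ r10 pz1 nr1] := p1; have [_ r20 pz2 nr2] := p2.
have /andP[_ uc] := cs_cycles ccs; have [s [us mc _ pc]] := cycle_rot_to uc z1c.
have z21 : z2 != z1.
  by apply: contraNneq h1 => <-; apply: (piece_mem p2); rewrite mem_head.
have /mem_split[c1 [c2 Es]] : z2 \in s by move: z2c; rewrite mc inE (negbTE z21).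
have ur z r w : w \notin V0 D -> piece w (z, r) -> uniq r by move=> w0 /(piece_uniq w0)/andP[].
have dis r : ~~ has [in c] r -> uniq r -> uniq (r ++ z1 :: s).
  by move=> nh uh; apply: uniq_cat_disjoint => //; rewrite -(eq_has mc).
apply: (@absorbs_tails _ _ _ _ c1 _ _ c2) => //; first by rewrite -Es.
- apply/uniq_count_le1 => y; move/uniq_count_le1/(_ y): (dis _ n2 (ur _ _ _ v0 p2)).
  by rewrite Es /= ?count_cat /= ?count_cat /= ?count_cat /=; clear; lia.
- apply/uniq_count_le1 => y; move/uniq_count_le1/(_ y): (dis _ n1 (ur _ _ _ u0 p1)).
  by rewrite Es /= ?count_cat /= ?count_cat /= ?count_cat /=; clear; lia.
Qed.

Lemma cycle_has_gadget (c : seq D) (X : {set D}) :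
  c \in cs -> #|X| <= 128 * d ^ 2 -> has_gadget c X.
Proof.
move=> ccs cX; have /andP[c0 uc] := cs_cycles ccs.
case: (classic (exists u a b, [/\ u \in c, u \notin X, u \notin V0 D, piece u (a, [:: b]) &
    (a \in c) && (b \in c)])).
  case=> u [a [b [uc' uX u0 pu /andP[ac bc]]]].
  have [s [us mc _ pc]] := cycle_rot_to uc bc.
  have ab : a != b by have := piece_uniq u0 pu; rewrite /= inE => /andP[].
  have /mem_split[c1 [c2 Es]] : a \in s by move: ac; rewrite mc inE (negbTE ab).
  rewrite Es in us mc pc.
  exact: (chord_gadget (ltnSn _) ccs pc us mc uc' uX u0 pu cX).
move=> no_chord.
have szc : 1000 * d ^ 2 <= size c.
  by apply: girth_le; apply: dicycle_edges => // e; exact: cycle_arc.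
have d0 : 0 < d.
  have [e ec] : exists e, e \in cycle_edges c.
    by case: (c) c0 => [|x [|y s]] // _; [exists (x, x)|exists (x, y)]; rewrite /= ?walk_edges_cons mem_head.
  apply: leq_trans (outdeg_le e.1); apply/card_gt0P; exists e.2; rewrite inE.
  exact: cycle_arc ec.
have sc : sorted (@Defs.arc D) c.
  case: (c) ccs => [|x s] // xs; rewrite /sorted -walk_path; apply/allP => e es.
  by apply: (cycle_arc xs); rewrite /= walk_edges_join mem_cat es.
(* Without a chord, a one-arc piece has only one end on [c], so every piece obtained is a head or a
   tail piece. *)
have free v : v \in c -> v \notin X -> v \notin V0 D ->
    (forall y, y \in vertices (trail v) -> y \notin zeros_near c) ->
    exists R, piece v R /\ (head_piece c v R \/ tail_piece c v R).
  move=> vc vX v0 far; case: (boolP (neg v)) => nv.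
    case: (neg_pieces vc nv far) => [[q [r [x [qc xc nr pR]]]]|[q [s [qc pR]]]].
      exists (q, r ++ [:: x]); split=> //; left; exists q, r, x; split=> //.
      by rewrite /= negb_or qc.
    exists (q, [:: s]); split=> //; right; exists q, [:: s]; split=> //=.
    rewrite orbF; apply/negP => sc'; apply: no_chord; exists v, q, s.
    by rewrite qc sc'; split.
  have pv : pos v by move: v0; rewrite V0E negb_and !negbK (negbTE nv) orbF.
  case: (pos_pieces vc pv far) => [[x [r [q [qc xc nr pR]]]]|[s [q [qc pR]]]].
    exists (x, r ++ [:: q]); split=> //; right; exists x, (r ++ [:: q]); split=> //.
    by rewrite has_cat /= orbF negb_or nr.
  exists (s, [:: q]); split=> //; left; exists s, [::], q; split=> //=.
  rewrite orbF; apply/negP => sc'; apply: no_chord; exists v, s, q.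
  by rewrite qc sc'; split.
(* Three vertices suffice, as two of the three pieces are of the same kind. Each new trail avoids
   the ends of the earlier pieces, at most four vertices. *)
have [|v1 [v1c v1X v10 far1]] := @pick_vertex c X set0 uc sc szc d0 cX; first by rewrite cards0.
have [|R1 [p1 k1]] := free v1 v1c v1X v10; first by move=> y /far1/andP[].
have [|v2 [v2c v2X v20 far2]] := @pick_vertex c X [set R1.1; target R1] uc sc szc d0 cX.
  by rewrite cards2; case: (_ != _).
have [|R2 [p2 k2]] := free v2 v2c v2X v20; first by move=> y /far2/andP[].
have [|v3 [v3c v3X v30 far3]] :=
    @pick_vertex c X ([set R1.1; target R1] :|: [set R2.1; target R2]) uc sc szc d0 cX.
  apply: leq_trans (leq_card_setU _ _) _; rewrite !cards2.
  by case: (_ != _); case: (_ != _).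
have [|R3 [p3 k3]] := free v3 v3c v3X v30; first by move=> y /far3/andP[].
have h12 : R1.1 \notin vertices (trail v2) by apply/negP => /far2/andP[_]; rewrite !in_set2 eqxx.
have t12 : target R1 \notin vertices (trail v2) by apply/negP => /far2/andP[_]; rewrite !in_set2 eqxx orbT.
have h13 : R1.1 \notin vertices (trail v3).
  by apply/negP => /far3/andP[_]; rewrite in_setU !in_set2 eqxx.
have t13 : target R1 \notin vertices (trail v3).
  by apply/negP => /far3/andP[_]; rewrite in_setU !in_set2 eqxx !orbT.
have h23 : R2.1 \notin vertices (trail v3).
  by apply/negP => /far3/andP[_]; rewrite in_setU !in_set2 eqxx !orbT.
have t23 : target R2 \notin vertices (trail v3).
  by apply/negP => /far3/andP[_]; rewrite in_setU !in_set2 eqxx !orbT.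
have w12 : gadget c v1 v2 R1 R2 -> has_gadget c X.
  by move=> G; exists v1, v2, R1, R2; rewrite v1c v2c v1X v2X v10 v20.
have w13 : gadget c v1 v3 R1 R3 -> has_gadget c X.
  by move=> G; exists v1, v3, R1, R3; rewrite v1c v3c v1X v3X v10 v30.
have w23 : gadget c v2 v3 R2 R3 -> has_gadget c X.
  by move=> G; exists v2, v3, R2, R3; rewrite v2c v3c v2X v3X v20 v30.
case: k1 => k1; case: k2 => k2; case: k3 => k3.
- by apply: w12; exact: heads_gadget.
- by apply: w12; exact: heads_gadget.
- by apply: w13; exact: heads_gadget.
- by apply: w23; exact: tails_gadget.
- by apply: w23; exact: heads_gadget.
- by apply: w13; exact: tails_gadget.
- by apply: w12; exact: tails_gadget.
- by apply: w12; exact: tails_gadget.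
Qed.

(** * Choosing one gadget for each cycle *)

Notation gadget_data := ((D * D) * ((D * seq D) * (D * seq D)))%type.

Definition owners (x : gadget_data) := [:: x.1.1; x.1.2].

Definition valid_gadget (c : seq D) (x : gadget_data) :=
  [/\ (x.1.1 \in c) && (x.1.2 \in c), (x.1.1 \notin V0 D) && (x.1.2 \notin V0 D) &
      gadget c x.1.1 x.1.2 x.2.1 x.2.2].

(** Fewer than [64 * d ^ 2] gadgets have fewer than [128 * d ^ 2] owners; with these excluded,
    another gadget is found. *)
Lemma gadget_list (c : seq D) n : c \in cs -> n <= 64 * d ^ 2 ->
  exists L, [/\ size L = n, forall x, x \in L -> valid_gadget c x &
                uniq (flatten [seq owners x | x <- L])].
Proof.
move=> ccs; elim: n => [|n IH] nd; first by exists [::].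
have [L [sL vL uL]] := IH (ltnW nd).
have [|u [v [R1 [R2 [uvc uvX uv0 G]]]]] :=
    @cycle_has_gadget c [set:: flatten [seq owners x | x <- L]] ccs.
  rewrite cardsE; apply: leq_trans (card_size _) _.
  have -> : size (flatten [seq owners x | x <- L]) = 2 * n.
    by rewrite -sL; elim: (L) => //= x l ->; clear; lia.
  by rewrite -[128]/(2 * 64) -mulnA leq_mul2l /= ltnW.
exists (((u, v), (R1, R2)) :: L); split=> /=; first by rewrite sL.
  by move=> x; rewrite inE => /orP[/eqP ->|/vL].
move: uvX; rewrite !in_set => /andP[uX vX].
have uv : u != v.
  case: G => pu _ h _ _; apply: contraNneq h => <-; apply: (piece_mem pu); exact: mem_head.
by rewrite inE negb_or uv uX vX.
Qed.

Notation gidx := ('I_(size cs) * 'I_(64 * d ^ 2))%type.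

Definition piece_ends (x : gadget_data) := [:: x.2.1.1; target x.2.1; x.2.2.1; target x.2.2].

(** One direction of not touching already makes the pieces of two gadgets compatible: different
    starts, different ends, no common edge. *)
Definition touches (x y : gadget_data) :=
  has (fun z => (z \in vertices (trail y.1.1)) || (z \in vertices (trail y.1.2))) (piece_ends x).

Section Conflicts.

Variable G : 'I_(size cs) -> 'I_(64 * d ^ 2) -> gadget_data.
Hypothesis G_valid : forall (i : 'I_(size cs)) a, valid_gadget (nth [::] cs i) (G i a).
Hypothesis G_inj : forall i a b w, w \in owners (G i a) -> w \in owners (G i b) -> a = b.

(** [y] lies on the trails of at most [4 * d] owners, each on at most [d] cycles, and on a given
    cycle an owner belongs to at most one gadget. *)
Lemma touched_card y :
  #|[set p : gidx | (y \in vertices (trail (G p.1 p.2).1.1)) || (y \in vertices (trail (G p.1 p.2).1.2))]|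
  <= 4 * d ^ 2.
Proof.
set S := finset _.
pose owner (p : gidx) := let: x := (G p.1 p.2).1 in if y \in vertices (trail x.1) then x.1 else x.2.
have owner_in p : owner p \in owners (G p.1 p.2).
  by rewrite /owner; case: ifP => _; rewrite !inE eqxx ?orbT.
pose phi p := (p.1, owner p).
have inj : injective phi.
  move=> [i a] [j b] [/= Eij]; rewrite -{j}Eij => Eo; congr (_, _).
  by apply: (@G_inj i _ _ (owner (i, a))); [exact: (owner_in (i, a))|rewrite Eo; exact: (owner_in (i, b))].
rewrite -(card_imset _ inj).
pose S' := \bigcup_(w in hits y) [set (i, w) | i in [set i : 'I_(size cs) | w \in nth [::] cs i]].
apply: (@leq_trans #|S'|).
  apply: subset_leq_card; apply/subsetP => q /imsetP[p pS ->].
  have [/andP[c1 c2] /andP[n1 n2] _] := G_valid p.1 p.2.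
  apply/bigcupP; exists (owner p).
    move: pS; rewrite [p \in _]in_set in_set /owner.
    by case: ifP => [h1 _|h1 /= h2]; rewrite ?n1 ?h1 ?n2.
  apply/imsetP; exists p.1 => //; rewrite in_set /owner.
  by case: ifP.
apply: leq_trans (card_bigcup_leq _ _) _.
apply: (@leq_trans (\sum_(w in hits y) d)).
  apply: leq_sum => w _; rewrite card_imset => [|i j []//].
  apply: leq_trans (cycles_through w).
  by rewrite -sum1dep_card -sum1_count (big_nth [::]) big_mkord.
by rewrite sum_nat_const -mulnn mulnA leq_mul2r hits_card orbT.
Qed.

Lemma touches_card x : #|[set p : gidx | touches x (G p.1 p.2)]| <= 16 * d ^ 2.
Proof.
pose S y := [set p : gidx | (y \in vertices (trail (G p.1 p.2).1.1)) ||
                           (y \in vertices (trail (G p.1 p.2).1.2))].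
have E : [set p : gidx | touches x (G p.1 p.2)] =
         S x.2.1.1 :|: S (target x.2.1) :|: (S x.2.2.1 :|: S (target x.2.2)).
  by apply/setP => p; rewrite !in_setU !in_set /touches /= orbF !orbA.
have le4 := touched_card; rewrite E -[16]/(4 + 4 + (4 + 4)) !mulnDl.
apply: leq_trans (leq_card_setU _ _) (leq_add _ _).
  exact: leq_trans (leq_card_setU _ _) (leq_add (le4 _) (le4 _)).
exact: leq_trans (leq_card_setU _ _) (leq_add (le4 _) (le4 _)).
Qed.

End Conflicts.

Lemma gadget_selection : 0 < d -> exists sel : 'I_(size cs) -> gadget_data,
  (forall i : 'I_(size cs), valid_gadget (nth [::] cs i) (sel i)) /\
  (forall i j, i != j -> ~~ touches (sel i) (sel j) \/ ~~ touches (sel j) (sel i)).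
Proof.
move=> d0; have g0 : 0 < 64 * d ^ 2 by rewrite muln_gt0 expn_gt0 d0.
have : forall i : 'I_(size cs), exists F : 'I_(64 * d ^ 2) -> gadget_data,
    (forall a, valid_gadget (nth [::] cs i) (F a)) /\
    (forall a b w, w \in owners (F a) -> w \in owners (F b) -> a = b).
  move=> i; have [L [sL vL uL]] := gadget_list (mem_nth [::] (ltn_ord i)) (leqnn _).
  case: L sL vL uL => [E|x0 L sL vL uL]; first by rewrite -E in g0.
  exists (fun a => nth x0 (x0 :: L) a); split=> [a|a b w ha hb].
    by apply: vL; rewrite mem_nth // sL.
  by apply/val_inj/(flatten_map_inj uL _ _ ha hb); rewrite sL.
case/fin_all_exists=> G hG.
have Gv i a := proj1 (hG i) a; have Gi i := proj2 (hG i).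
(* Only touching both ways is a conflict; this is symmetric, and the degree is bounded by what a
   single gadget touches. *)
pose conflict (p q : gidx) := touches (G p.1 p.2) (G q.1 q.2) && touches (G q.1 q.2) (G p.1 p.2).
have csym : symmetric conflict by move=> p q; rewrite /conflict andbC.
have cdeg p : #|[set q : gidx | (q.1 != p.1) && conflict p q]| <= 16 * d ^ 2.
  apply: leq_trans (touches_card Gv Gi (G p.1 p.2)); apply: subset_leq_card.
  by apply/subsetP => q; rewrite !in_set => /and3P[].
have [|f hf] := independent_transversal csym cdeg _ g0; first by rewrite mulnA.
exists (fun i => G i (f i)); split=> // i j /hf; rewrite negb_and => /orP[]; first by left.
by right.
Qed.

(** * Assembling the final path decomposition *)

Lemma trail_edge_inj t t' e : t \in ts -> t' \in ts ->
  e \in walk_edges (vertices t) -> e \in walk_edges (vertices t') -> t = t'.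
Proof.
move=> tts t'ts et et'.
have uA : uniq (flatten [seq walk_edges (vertices t) | t <- ts]).
  rewrite (perm_uniq ts_perm); have := enum_uniq (arcs D).
  by rewrite (perm_uniq arcs_perm) cat_uniq => /and3P[].
rewrite -(nth_index t tts) -(nth_index t t'ts); congr nth.
by apply: (flatten_map_inj (i0 := t) (x := e) uA); rewrite ?index_mem ?nth_index.
Qed.

Lemma trails_consistent : consistent D.
Proof.
(* For [d = 0] there are no arcs, and the empty list of paths will do. *)
have [d00|d0] := posnP d.
  apply: (@consistent_of_paths D [::]) => //.
  rewrite (_ : enum _ = [::]) //; case E: (enum _) => [|e l] //.
  have : e \in enum (arcs D) by rewrite E mem_head.
  rewrite mem_enum inE => ae; have := outdeg_le e.1; rewrite d00 leqn0 cards_eq0.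
  by move/eqP/setP/(_ e.2); rewrite !inE ae.
have [sel [sel_valid sel_free]] := gadget_selection d0.
pose rho (j : 'I_(size cs) * bool) := if j.2 then (sel j.1).2.1 else (sel j.1).2.2.
pose own (j : 'I_(size cs) * bool) := if j.2 then (sel j.1).1.1 else (sel j.1).1.2.
have rho_piece j : own j \notin V0 D /\ piece (own j) (rho j).
  by case: j => i b; have [_ /andP[n1 n2] [p1 p2 _ _ _]] := sel_valid i; case: b.
have far i i' b b' : ~~ touches (sel i) (sel i') ->
    (rho (i, b)).1 \notin vertices (trail (own (i', b'))) /\
    target (rho (i, b)) \notin vertices (trail (own (i', b'))).
  rewrite /touches /piece_ends /rho /own /= orbF !negb_or.
  by case/and4P=> /andP[? ?] /andP[? ?] /andP[? ?] /andP[? ?]; case: b; case: b'.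
(* Of two pieces, one has both ends off the trail of the other: inside a gadget by definition,
   across cycles by the selection. *)
have far2 j j' : j != j' ->
    ((rho j).1 \notin vertices (trail (own j')) /\ target (rho j) \notin vertices (trail (own j'))) \/
    ((rho j').1 \notin vertices (trail (own j)) /\ target (rho j') \notin vertices (trail (own j))).
  case: j j' => i b [i' b']; have [<-|ii'] := eqVneq i i'.
    rewrite xpair_eqE eqxx /= => bb'; have [_ _ [_ _ h1 h2 _]] := sel_valid i.
    by case: b b' bb' => -[] // _; [left|right].
  by move=> _; case: (sel_free i i' ii') => h; [left|right]; apply: far.
have rho_mem j : (rho j).1 \in vertices (trail (own j)) /\ target (rho j) \in vertices (trail (own j)).
  by have [_ pj] := rho_piece j; split; apply: (piece_mem pj); [exact: mem_head|exact: mem_last].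
have start_inj : injective (fun j => (rho j).1).
  move=> j j' E; apply: contraTeq isT => /far2[[h _]|[h _]].
    by rewrite /= in E; rewrite E (proj1 (rho_mem j')) in h.
  by rewrite /= in E; rewrite -E (proj1 (rho_mem j)) in h.
have end_inj : injective (fun j => target (rho j)).
  move=> j j' E; apply: contraTeq isT => /far2[[_ h]|[_ h]].
    by rewrite /= in E; rewrite E (proj2 (rho_mem j')) in h.
  by rewrite /= in E; rewrite -E (proj2 (rho_mem j)) in h.
(* A common edge forces a common trail, which would contain the ends of both pieces. *)
have edge_inj j j' e : e \in walk_edges (vertices (rho j)) -> e \in walk_edges (vertices (rho j')) -> j = j'.
  have in_trail l : e \in walk_edges (vertices (rho l)) -> e \in walk_edges (vertices (trail (own l))).
    by have [_ [[s1 [s2 ->]] _ _ _]] := rho_piece l; exact: walk_edges_infix.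
  move=> ej ej'; have E : trail (own j) = trail (own j').
    apply: (trail_edge_inj _ _ (in_trail _ ej) (in_trail _ ej')).
      exact: nonzero_trail (proj1 (rho_piece j)).
    exact: nonzero_trail (proj1 (rho_piece j')).
  apply: contraTeq isT => /far2[[h _]|[h _]].
    by rewrite -E (proj1 (rho_mem j)) in h.
  by rewrite E (proj1 (rho_mem j')) in h.
pose l := enum 'I_(size cs).
pose js := [seq (i, true) | i <- l] ++ [seq (i, false) | i <- l].
have ujs : uniq js.
  have ul : uniq l by exact: enum_uniq.
  have inj (b : bool) : injective (fun i : 'I_(size cs) => (i, b)) by move=> i i' [].
  rewrite cat_uniq (map_inj_uniq (inj true)) (map_inj_uniq (inj false)) ul /= andbT.
  by apply/hasPn => j /mapP[i _ ->]; apply/negP => /mapP[].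
pose Rs := map rho js.
pose RE := flatten [seq walk_edges (vertices R) | R <- Rs].
have uA : uniq A by have := enum_uniq (arcs D); rewrite (perm_uniq arcs_perm) cat_uniq => /and3P[].
have uRE : uniq RE.
  rewrite /RE /Rs -map_comp; apply: uniq_flatten_map => // [j _|j j' e _ _]; last exact: edge_inj.
  by have [n p] := rho_piece j; apply: uniq_walk_edges; exact: piece_uniq p.
have RE_A : {subset RE <= A}.
  move=> e /flatten_mapP[R /mapP[j _ ->]] eR; have [n p] := rho_piece j; exact: (piece_edges n p eR).
(* Only the edges off the pieces are decomposed anew; the pieces go into the absorbing paths. *)
pose A' := [seq e <- A | e \notin RE].
have pA : perm_eq A (RE ++ A').
  apply: uniq_perm => //.
    apply: uniq_cat_disjoint => //; first exact: filter_uniq.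
    by apply/hasPn => e eR; rewrite mem_filter /= eR.
  by move=> e; rewrite mem_cat mem_filter; case: (boolP (e \in RE)) => [/RE_A|].
have aA' : acyclic A' by apply: acyclic_sub A_acyclic => e; rewrite mem_filter => /andP[].
have [ps [pps ups lps]] := acyclic_paths aA'.
have good_ps : all (@good_path D) ps.
  apply/allP => t tps; have [ut t2] := ups t tps; have [s1 s2] := unlinked_start lps tps.
  have count_start v : count (fun R : D * seq D => R.1 == v) Rs <= 1.
    rewrite /Rs count_map -(count_map (fun j => (rho j).1) (pred1 v)) count_uniq_mem ?leq_b1 //.
    by rewrite map_inj_uniq.
  have count_end v : count (fun R : D * seq D => target R == v) Rs <= 1.
    rewrite /Rs count_map -(count_map (fun j => target (rho j)) (pred1 v)) count_uniq_mem ?leq_b1 //.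
    by rewrite map_inj_uniq.
  have start_pos v : 0 < count (fun R : D * seq D => R.1 == v) Rs -> pos v.
    by rewrite -has_count => /hasP[R /mapP[j _ ->] /eqP <-]; have [_ []] := rho_piece j.
  have end_neg v : 0 < count (fun R : D * seq D => target R == v) Rs -> neg v.
    by rewrite -has_count => /hasP[R /mapP[j _ ->] /eqP <-]; have [_ []] := rho_piece j.
  have balance v : edges_from v A + count (fun R : D * seq D => target R == v) Rs + edges_into v A' =
      edges_into v A + count (fun R : D * seq D => R.1 == v) Rs + edges_from v A'.
    have H := walks_degrees v Rs.
    have E1 : edges_from v A = edges_from v RE + edges_from v A'.
      by rewrite /edges_from (permP pA) count_cat.
    have E2 : edges_into v A = edges_into v RE + edges_into v A'.
      by rewrite /edges_into (permP pA) count_cat.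
    move: H; rewrite E1 E2 -/RE; clear; set a := count (fun R : D * seq D => R.1 == _) Rs.
    set b := count (fun R : D * seq D => target R == _) Rs; move: a b.
    move: (edges_from v RE) (edges_into v RE) (edges_from v A') (edges_into v A').
    lia.
  have fromE v : edges_from v (flatten [seq walk_edges (vertices t) | t <- ps]) = edges_from v A'.
    by rewrite /edges_from (permP pps).
  have intoE v : edges_into v (flatten [seq walk_edges (vertices t) | t <- ps]) = edges_into v A'.
    by rewrite /edges_into (permP pps).
  rewrite !fromE !intoE in s1 s2.
  have [p1 n1] : pos t.1 = (edges_into t.1 A < edges_from t.1 A) /\
                 neg t.1 = (edges_from t.1 A < edges_into t.1 A).
    by have [e1 e2] := arcs_degrees t.1; rewrite /pos /neg e1 e2 !ltn_add2l.
  have [p2 n2] : pos (target t) = (edges_into (target t) A < edges_from (target t) A) /\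
                 neg (target t) = (edges_from (target t) A < edges_into (target t) A).
    by have [e1 e2] := arcs_degrees (target t); rewrite /pos /neg e1 e2 !ltn_add2l.
  apply/and4P; split=> //.
    (* Putting the pieces back lowers the positive balance at [t.1] only if a piece ends there, and
       then by at most one, so it stays nonnegative; but the end of a piece is negative. *)
    move: s1 (balance t.1) (count_end t.1) (@end_neg t.1); rewrite p1 n1.
    clear; set a := count (fun R : D * seq D => R.1 == _) Rs.
    set b := count (fun R : D * seq D => target R == _) Rs; move: a b => a b.
    move: (edges_from t.1 A) (edges_into t.1 A) (edges_from t.1 A') (edges_into t.1 A').
    by case: b => [|[|b]] x y z w h1 h2 h3 h4 //; try have := h4 isT; lia.
  move: s2 (balance (target t)) (count_start (target t)) (@start_pos (target t)); rewrite p2 n2.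
  clear; set a := count (fun R : D * seq D => R.1 == _) Rs.
  set b := count (fun R : D * seq D => target R == _) Rs; move: a b => a b.
  move: (edges_from (target t) A) (edges_into (target t) A) (edges_from (target t) A') (edges_into (target t) A').
  by case: a => [|[|a]] x y z w h1 h2 h3 h4 //; try have := h4 isT; lia.
have : forall i : 'I_(size cs), exists P : (D * seq D) * (D * seq D),
    [/\ good_path P.1, good_path P.2 &
      perm_eq (walk_edges (vertices P.1) ++ walk_edges (vertices P.2))
        (cycle_edges (nth [::] cs i) ++ walk_edges (vertices (rho (i, true))) ++
         walk_edges (vertices (rho (i, false))))].
  by move=> i; have [_ _ [_ _ _ _ [P1 [P2 h]]]] := sel_valid i; exists (P1, P2).
case/fin_all_exists=> P hP.
(* Two paths for each cycle with its two pieces, together with the paths of [A']. *)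
apply: (@consistent_of_paths D ([seq (P i).1 | i <- l] ++ [seq (P i).2 | i <- l] ++ ps)).
  have csE : map (@cycle_edges D) cs = [seq cycle_edges (nth [::] cs (i : 'I_(size cs))) | i <- l].
    by rewrite -{1}(mkseq_nth [::] cs) /mkseq -val_enum_ord -!map_comp.
  have key a (l' : seq 'I_(size cs)) :
      count a (flatten [seq cycle_edges (nth [::] cs (i : 'I_(size cs))) | i <- l']) +
      (count a (flatten [seq walk_edges (vertices (rho (i, true))) | i <- l']) +
       count a (flatten [seq walk_edges (vertices (rho (i, false))) | i <- l'])) =
      count a (flatten [seq walk_edges (vertices (P i).1) | i <- l']) +
      count a (flatten [seq walk_edges (vertices (P i).2) | i <- l']).
    elim: l' => [|i l' IH] //=; rewrite !count_cat.
    have [_ _ /permP/(_ a)] := hP i; rewrite !count_cat => E.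
    move: E IH; clear.
    move: (count a (cycle_edges _)) (count a (walk_edges (vertices (rho (i, true)))))
      (count a (walk_edges (vertices (rho (i, false))))) (count a (walk_edges (vertices (P i).1)))
      (count a (walk_edges (vertices (P i).2))) => x1 x2 x3 x4 x5.
    move: (count a (flatten [seq cycle_edges _ | _ <- l']))
      (count a (flatten [seq walk_edges (vertices (rho (_, true))) | _ <- l']))
      (count a (flatten [seq walk_edges (vertices (rho (_, false))) | _ <- l']))
      (count a (flatten [seq walk_edges (vertices (P _).1) | _ <- l']))
      (count a (flatten [seq walk_edges (vertices (P _).2) | _ <- l'])).
    lia.
  apply/permP => a; rewrite (permP arcs_perm) csE !map_cat !flatten_cat !count_cat (permP pA) (permP pps).
  rewrite count_cat /RE /Rs /js !map_cat flatten_cat count_cat -!map_comp !addnA -key !addnA.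
  by [].
rewrite !all_cat good_ps !andbT; apply/andP; split; apply/allP => t /mapP[i _ ->]; by have [] := hP i.
Qed.

End Trails.

(** * From the hypotheses on [D] to its cycles and trails *)

Theorem theorem3p2 (d : nat) (D : digraph) (k : nat)
    (hdeg : maxsemideg D <= d)
    (hgirth : exnat_ge (girth D) (1000 * d ^ 2))
    (hk : 20 * d ^ 2 + 2 <= k)
    (hsparse : sparse k (V0 D)) :
  consistent D.
Proof.
have deg_le (v : D) : maxn (outdeg v) (indeg v) <= d.
  exact: leq_trans (leq_bigmax (F := fun v : D => maxn (outdeg v) (indeg v)) v) hdeg.
have out_le (v : D) : outdeg v <= d by exact: leq_trans (leq_maxl _ _) (deg_le v).
have in_le (v : D) : indeg v <= d by exact: leq_trans (leq_maxr _ _) (deg_le v).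
have [cs [A [pE aA hcs]]] := cycle_decomposition (enum_uniq (arcs D)).
have [ts [pts uts lts]] := acyclic_paths aA.
apply: (trails_consistent out_le in_le _ hk hsparse pE aA hcs pts).
  by move/girth_geP: hgirth.
(* The ends of trails have the right signs in [A], hence in [D], since the cycles are balanced. *)
apply/allP => t tts; have [ut t2] := uts t tts; have [] := unlinked_start lts tts.
rewrite /edges_from /edges_into !(permP pts) => s1 s2; apply/and4P; split=> //.
  by have [e1 e2] := arcs_degrees pE t.1; rewrite /pos e1 e2 ltn_add2l.
by have [e1 e2] := arcs_degrees pE (target t); rewrite /neg e1 e2 ltn_add2l.
Qed.
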